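(* Let $q=p^m$ with $p$ prime, $m,n\ge1$, and let $L(X)=a_0X+a_1X^q+\cdots+a_{n-1}X^{q^{n-1}}\in\mathbb{F}_{q^n}[X]$ with $(a_1,\dots,a_{n-1})\neq(0,\dots,0)$. For each integer $1\le j\le q^n-2$ with $\gcd(j,q^n-1)=1$ let $\ell(j)=\max\{\mathrm{Lead}(\mathrm{Res}(j(q^i-1))):1\le i\le n-1,\ a_i\neq0\}$, and let $\ell=\min_j\ell(j)$, the minimum taken over all integers $1\le j\le q^n-2$ with $\gcd(j,q^n-1)=1$. Then: (1) If $\mathrm{Tr}_{q^n/q}(a_0)\neq0$ and $q^n+1-\frac{(q-1)(\ell-1)}{2}\lfloor 2q^{n/2}\rfloor>1$, then it is not the case that $\mathrm{Tr}_{q^n/q}(L(x)/x)\neq0$ for all $x\in\mathbb{F}_{q^n}^*$. (2) If $\mathrm{Tr}_{q^n/q}(a_0)=0$ and $q^n+1-\frac{(q-1)(\ell-1)}{2}\lfloor 2q^{n/2}\rfloor>q+1$, then it is not the case that $\mathrm{Tr}_{q^n/q}(L(x)/x)\neq0$ for all $x\in\mathbb{F}_{q^n}^*$.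
   Context: $\mathrm{Tr}_{q^n/q}$ is the trace from $\mathbb{F}_{q^n}$ to $\mathbb{F}_q$. $\mathrm{Res}:\mathbb{Z}\to\{0,1,\dots,q^n-2\}$ is the map with $\mathrm{Res}(j)\equiv j\pmod{q^n-1}$. $\mathrm{Lead}:\{0,\dots,p^{mn}-2\}\to\{0,\dots,p^{mn}-2\}$ sends $j$ to the smallest integer $k\in\{0,\dots,p^{mn}-2\}$ such that $k\equiv jp^u\pmod{p^{mn}-1}$ for some integer $u\ge0$ (the least element of the $p$-cyclotomic coset of $j$ modulo $p^{mn}-1$). *)

(* Defs.v *)
From HB Require Import structures.
From mathcomp Require Import all_boot all_order all_algebra all_field.
From mathcomp Require Import boolp.

Set Implicit Arguments.
Unset Strict Implicit.
Unset Printing Implicit Defensive.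

Import Order.TTheory GRing.Theory Num.Theory.

Local Open Scope ring_scope.

(* N stands for q ^ n - 1 throughout. *)
Definition Res (N : nat) (j : int) : nat := `|(j %% N%:Z)%Z|%N.

(* Bounded minima are written \big[minn/N]_(k < N | P k) k: every admissible
   value is below N, so the default N acts as +oo and is returned only when the
   index set is empty.  The exponent u ranges over all of nat, hence the
   classical boolean `[< _ >]. *)
Definition Lead (p N j : nat) : nat :=
  \big[minn/N]_(k < N | `[< exists u : nat, k = j * p ^ u %[mod N] >]) k.

Definition linearized (K : nzRingType) (q n : nat) (a : 'I_n -> K) : {poly K} :=
  \sum_(i < n) a i *: 'X^(q ^ i).

Definition ell_at (K : nzRingType) (p q n : nat) (a : 'I_n -> K) (j : nat) : nat :=
  \max_(i < n | (0 < i)%N && (a i != 0))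
    Lead p (q ^ n - 1) (Res (q ^ n - 1) (j%:Z * ((q ^ i)%:Z - 1))).

(* The values ell_at p q a j are below q ^ n - 1, and j = 1 is admissible as
   soon as q ^ n > 2. *)
Definition ell (K : nzRingType) (p q n : nat) (a : 'I_n -> K) : nat :=
  \big[minn/(q ^ n - 1)%N]_(1 <= j < q ^ n - 1 | coprime j (q ^ n - 1))
    ell_at p q a j.

(* q ^ (n / 2) is the n-th power of the nonnegative square root of q in algC. *)
Definition HW_bound (q n l : nat) : rat :=
  (q ^ n)%:R + 1
  - (q%:R - 1) * (l%:R - 1) / 2%:R
    * (Num.floor (2%:R * sqrtC (q%:R : algC) ^+ n))%:~R.

(* Every finite extension of a finite field is a splitting field
   (FinSplittingFieldType), so taking L in splittingFieldType is no restriction;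
   it is what galTrace requires. *)
Definition Tr (K : finFieldType) (L : splittingFieldType K) (x : L) : L :=
  galTrace 1%VS {:L} x.

(* Main.v *)
Require Import Defs.
From HB Require Import structures.
From mathcomp Require Import all_boot all_order all_algebra all_field pgroup cyclic.
From mathcomp Require boolp.
From mathcomp Require Import zify ring lra.

Set Implicit Arguments.
Unset Strict Implicit.
Unset Printing Implicit Defensive.

Import Order.TTheory GRing.Theory Num.Theory.

Local Open Scope ring_scope.

(** Substituting [x^j] for [x] does not change the question and turns
    [Tr (L(x)/x)] into [Tr (a_0 + sum_i a_i x^(j (q^i - 1)))].  For an additive
    character [psi] that factors through [Tr] and is invariant under [x -> x^p],
    each monomial may be replaced by a [p]-power twist with exponent
    [Lead (...)]; so, for every nonzero [b] in [F_q], the sum of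
    [psi (b L(x^j)/x^j)] is the exponential sum of a polynomial of degree [ell],
    prime to [p].  If [Tr (L(x)/x)] never vanishes, these [q - 1] sums add up to
    [-q^n] or to [q - q^n].

    Weil's theorem for these sums is proved by Stepanov's method.  The Newton
    identities show that the L-function of [psi(f)] is a polynomial of degree
    [d - 1], [d = deg f], with reciprocal roots [w].  Stepanov's auxiliary
    polynomial on [Y^Q - Y = f(X)] bounds the sums over the extensions of even
    degree, whence [|w|^2 <= Q] for all [w]; and the leading coefficient of the
    L-function is a Gauss sum of the ring [F[u]/u^(d+1)], of square modulus
    [Q^(d-1)], whence [|w|^2 = Q].

    Finally (Serre) let [w] run over the [(q - 1)(ell - 1)] roots of all these
    L-functions, so that [|w|^2 = q^n], and let [B] be the least integer above
    [2 q^(n/2)].  The numbers [B - w - w^*] are positive algebraic integers with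
    rational power sums, so their product is a positive integer; by the AM-GM
    inequality their sum is at least [(q - 1)(ell - 1)], hence the sum of the [w]
    is at most [(q - 1)(ell - 1)/2 * floor (2 q^(n/2))]. *)

(** * Newton's identities *)

(* [X A'(X) + A(X) sum_(j > 0) s_j X^j = 0], coefficientwise. *)
Definition newton (R : nzRingType) (A : {poly R}) (s : nat -> R) :=
  forall k, A`_k.+1 *+ k.+1 + \sum_(i < k.+1) A`_i * s (k.+1 - i)%N = 0.

Section Newton.
Variable R : comNzRingType.
Implicit Types (A B : {poly R}) (s t : nat -> R).

Definition trunc_series s n : {poly R} := \poly_(j < n.+1) (if j == 0 then 0 else s j).

Lemma newton_coef A s n k : newton A s -> (k <= n)%N ->
  ('X * A^`() + A * trunc_series s n)`_k = 0.
Proof.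
case: k => [|k] hA hk.
  by rewrite coefD coefXM add0r coefM big_ord1 coef_poly mulr0.
rewrite coefD coefXM /= coef_deriv coefM big_ord_recr /= subnn.
rewrite [X in _ * X]coef_poly /= mulr0 addr0 -[RHS](hA k).
congr (_ + _); apply: eq_bigr => i _; have hi := ltn_ord i; rewrite coef_poly.
by rewrite ifT; [rewrite ifF //|]; lia.
Qed.

Lemma newton_of_coef A s :
  (forall n, ('X * A^`() + A * trunc_series s n)`_n = 0) -> newton A s.
Proof.
move=> h k; move: (h k.+1).
rewrite coefD coefXM /= coef_deriv coefM big_ord_recr /= subnn.
rewrite [X in _ * X]coef_poly /= mulr0 addr0 => e; rewrite -[RHS]e.
congr (_ + _); apply: eq_bigr => i _; have hi := ltn_ord i; rewrite coef_poly.
by rewrite ifT; [rewrite ifF //|]; lia.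
Qed.

(** The identity reads [X A' = - A S] with [S] the series of the [s_j]: it concerns the logarithmic
    derivative, which turns products into sums. Truncating [S] keeps the computation among
    polynomials. *)
Lemma newtonM A B s t :
  newton A s -> newton B t -> newton (A * B) (fun j => s j + t j).
Proof.
move=> hA hB; apply: newton_of_coef => n.
have -> : trunc_series (fun j => s j + t j) n = trunc_series s n + trunc_series t n.
  by apply/polyP => j; rewrite coefD !coef_poly; case: (j < n.+1)%N; case: (j == 0)%N; rewrite ?addr0.
have -> : 'X * (A * B)^`() + A * B * (trunc_series s n + trunc_series t n)
        = ('X * A^`() + A * trunc_series s n) * B + A * ('X * B^`() + B * trunc_series t n).
  by rewrite derivM; ring.
rewrite coefD !coefM !big1 ?addr0 // => i _.
  by rewrite (newton_coef hB) ?mulr0 //; lia.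
by rewrite (newton_coef hA) ?mul0r // -ltnS.
Qed.

Lemma newton1 : newton (1 : {poly R}) (fun _ => 0).
Proof.
by move=> k; rewrite coef1 mul0rn add0r big1 // => i _; rewrite mulr0.
Qed.

Lemma newton_linear (x : R) : newton (1 - x *: 'X) (fun j => x ^+ j).
Proof.
move=> k; rewrite big_ord_recl coefB coef1 coefZ coefX sub0r.
case: k => [|k].
  by rewrite big_ord0 coefB coef1 coefZ coefX /=; ring.
rewrite big_ord_recl big1 => [|i _]; last first.
  by rewrite coefB coef1 coefZ coefX /= mulr0 subr0 mul0r.
rewrite !coefB !coef1 !coefZ !coefX /= /bump /= mulr0 oppr0 mul0rn mulr1.
by rewrite subn1 /= subn0 exprS; ring.
Qed.

Definition rev_roots (xs : seq R) : {poly R} := \prod_(x <- xs) (1 - x *: 'X).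

Lemma newton_eq A s t : s =1 t -> newton A s -> newton A t.
Proof.
by move=> e h k; rewrite -[RHS](h k); congr (_ + _); apply: eq_bigr => i _; rewrite e.
Qed.

Lemma newton_rev_roots (xs : seq R) :
  newton (rev_roots xs) (fun j => \sum_(x <- xs) x ^+ j).
Proof.
rewrite /rev_roots; elim: xs => [|x xs IH].
  by rewrite big_nil; apply: newton_eq newton1 => j; rewrite big_nil.
rewrite big_cons; apply: newton_eq (newtonM (newton_linear x) IH) => j.
by rewrite big_cons.
Qed.

(** As the constant coefficient is 1, the identity of index [k] expresses [s_(k+1)] by the
    coefficients up to [k+1] and the earlier [s_j]. *)
Lemma newton_uniq_upto A B s t d : A`_0 = 1 -> newton A s -> newton B t ->
  (forall i, (i <= d)%N -> A`_i = B`_i) ->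
  forall j, (0 < j <= d)%N -> s j = t j.
Proof.
move=> A0 hA hB e; elim/ltn_ind => -[|k] // IH /= hk.
have := hA k; have := hB k; rewrite !big_ord_recl /= !subn0 -!e // A0 !mul1r.
have -> : \sum_(i < k) B`_(bump 0 i) * t (k.+1 - bump 0 i)%N =
          \sum_(i < k) A`_(bump 0 i) * s (k.+1 - bump 0 i)%N.
  apply: eq_bigr => i _; have hi := ltn_ord i.
  by rewrite e ?IH // /bump /=; lia.
by move=> hb ha; move: (etrans ha (esym hb)) => /addrI /addIr.
Qed.

Lemma newton_uniq A s t : A`_0 = 1 -> newton A s -> newton A t ->
  forall j, (0 < j)%N -> s j = t j.
Proof.
by move=> A0 hs ht j hj; apply: (newton_uniq_upto (d := j) A0 hs ht); rewrite ?hj /=.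
Qed.

(* [p_1; ...; p_n], so that the entry of index [k] is [p_(k+1)]. *)
Fixpoint psums A n : seq R :=
  if n isn't k.+1 then [::]
  else rcons (psums A k)
    (- (A`_k.+1 *+ k.+1) - \sum_(i < k) A`_i.+1 * (psums A k)`_(k - i.+1)%N).

(** Power sums of the reciprocal roots of [A], computed in the base ring without any roots. Index 0
    gets the conventional value 0. *)
Definition psum A j := if j is k.+1 then (psums A k.+1)`_k else 0.

Arguments psum : simpl never.

Lemma size_psums A n : size (psums A n) = n.
Proof. by elim: n => //= n IH; rewrite size_rcons IH. Qed.

Lemma nth_psums A n k : (k < n)%N -> (psums A n)`_k = psum A k.+1.
Proof.
elim: n => // n IH; rewrite ltnS leq_eqVlt => /orP[/eqP->//|hk].
by rewrite [psums A n.+1]/= nth_rcons size_psums hk IH.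
Qed.

Lemma psumE A k :
  psum A k.+1 = - (A`_k.+1 *+ k.+1) - \sum_(i < k) A`_i.+1 * psum A (k - i)%N.
Proof.
rewrite /psum [psums A k.+1]/= nth_rcons size_psums ltnn eqxx.
congr (_ - _); apply: eq_bigr => i _; have hi := ltn_ord i.
rewrite nth_psums; last by lia.
by have -> : (k - i = (k - i.+1).+1)%N by lia.
Qed.

Lemma newton_psum A : A`_0 = 1 -> newton A (psum A).
Proof.
move=> A0 k; rewrite big_ord_recl subn0 A0 mul1r psumE.
rewrite [X in _ + (_ - X + _)](_ : _ = \sum_(i < k) A`_(bump 0 i) * psum A (k.+1 - bump 0 i)%N).
  by ring.
by apply: eq_bigr => i _.
Qed.

Lemma psumM A B j : A`_0 = 1 -> B`_0 = 1 -> psum (A * B) j = psum A j + psum B j.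
Proof.
move=> A0 B0; case: j => [|j]; first by rewrite addr0.
have AB0 : (A * B)`_0 = 1 by rewrite coefM big_ord1 A0 B0 mulr1.
apply: (newton_uniq (t := fun j => psum A j + psum B j) AB0 (newton_psum AB0)) => //.
exact: newtonM (newton_psum A0) (newton_psum B0).
Qed.

Lemma psum_rev_roots (xs : seq R) j : (0 < j)%N ->
  psum (rev_roots xs) j = \sum_(x <- xs) x ^+ j.
Proof.
have A0 : (rev_roots xs)`_0 = 1.
  rewrite -horner_coef0 horner_prod big1 // => x _.
  by rewrite !hornerE subr0.
move=> hj; exact: (newton_uniq (t := fun j => \sum_(x <- xs) x ^+ j) A0 (newton_psum A0) (newton_rev_roots xs) hj).
Qed.

Lemma eq_psum A B d : A`_0 = 1 -> (forall i, (i <= d)%N -> A`_i = B`_i) ->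
  forall j, (j <= d)%N -> psum A j = psum B j.
Proof.
move=> A0 e [|j] // hj.
have B0 : B`_0 = 1 by rewrite -e.
by apply: (newton_uniq_upto A0 (newton_psum A0) (newton_psum B0) e).
Qed.

(** The changed coefficient first enters Newton's identities in the one for [p_d], through the term
    [d A_d]. *)
Lemma psum_addX A d c : A`_0 = 1 -> (0 < d)%N ->
  psum (A + c *: 'X^d) d = psum A d - c *+ d.
Proof.
case: d => // d A0 _.
have eA i : (i <= d)%N -> (A + c *: 'X^(d.+1))`_i = A`_i.
  by move=> hi; rewrite coefD coefZ coefXn ltn_eqF // mulr0 addr0.
rewrite !psumE coefD coefZ coefXn eqxx mulr1 mulrnDl opprD.
rewrite -!addrA; congr (_ + _); rewrite addrC; congr (_ - _).
congr (- _); apply: eq_bigr => i _; rewrite eA //; congr (_ * _).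
by apply: (eq_psum (d := d)); rewrite ?eA //; lia.
Qed.

End Newton.
Arguments psum : simpl never.

Lemma map_psum (R S : comNzRingType) (f : {rmorphism R -> S}) (A : {poly R}) j :
  A`_0 = 1 -> f (psum A j) = psum (map_poly f A) j.
Proof.
case: j => [|j] A0; first by rewrite rmorph0.
have B0 : (map_poly f A)`_0 = 1 by rewrite coef_map /= A0 rmorph1.
apply: (@newton_uniq _ (map_poly f A) (fun i => f (psum A i)) _ B0) => //.
  move=> k; rewrite -[RHS](rmorph0 f) -(newton_psum A0 k) rmorphD rmorphMn coef_map.
  by congr (_ + _); rewrite rmorph_sum; apply: eq_bigr => i _; rewrite rmorphM coef_map.
exact: newton_psum.
Qed.

Lemma size_rev_roots (R : idomainType) (xs : seq R) :
  (size (rev_roots xs) <= (size xs).+1)%N.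
Proof.
rewrite /rev_roots; elim: xs => [|x xs IH]; first by rewrite big_nil size_poly1.
rewrite big_cons; apply: (leq_trans (size_polyMleq _ _)) => /=.
have : (size (1 - x *: 'X)%R <= 2)%N.
  rewrite (leq_trans (size_polyD _ _)) // geq_max size_poly1 size_polyN /=.
  by rewrite (leq_trans (size_scale_leq _ _)) // size_polyX.
by move=> h; rewrite -subn1 leq_subLR; apply: leq_add h IH.
Qed.

Lemma coef_rev_roots (R : idomainType) (xs : seq R) i : (i <= size xs)%N ->
  (rev_roots xs)`_i = (\prod_(x <- xs) ('X - x%:P))`_(size xs - i).
Proof.
rewrite /rev_roots; elim: xs i => [|x xs IH] i.
  by rewrite leqn0 => /eqP ->; rewrite !big_nil.
rewrite /= => hi; rewrite !big_cons mulrBl mulrBl mul1r !coefB -scalerAl coefZ coefXM coefXM coefCM.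
case: i hi => [|i] hi.
  rewrite subn0 /= mulr0 subr0 IH // subn0 [X in x * X]nth_default ?mulr0 ?subr0 //.
  by rewrite size_prod_XsubC.
rewrite subSS /=; case: (ltnP i (size xs)) => h.
  rewrite ifF; last by lia.
  by rewrite (IH i.+1) // (IH i (ltnW h)) subnS.
have -> : i = size xs by apply/eqP; rewrite eqn_leq h -ltnS hi.
rewrite (IH (size xs)) // subnn /= nth_default //.
exact: size_rev_roots.
Qed.

(** * Stepanov's method for the curve [Y^Q - Y = f(X)] *)

Lemma expr_sum_pchar (R : comNzRingType) (I : Type) (r : seq I) (P : pred I) (F : I -> R) n :
  [pchar R].-nat n -> (\sum_(i <- r | P i) F i) ^+ n = \sum_(i <- r | P i) F i ^+ n.
Proof.
move=> hn; apply: (big_morph (fun x => x ^+ n)) => [x y|].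
  exact: exprDn_pchar.
by rewrite expr0n; case: n hn.
Qed.

Lemma exprB_pchar (R : comNzRingType) (x y : R) n :
  [pchar R].-nat n -> (x - y) ^+ n = x ^+ n - y ^+ n.
Proof. by move=> hn; rewrite exprDn_pchar // exprNn_pchar. Qed.

Lemma closed_nth_root (K : closedFieldType) n (x : K) :
  (0 < n)%N -> exists y, y ^+ n = x.
Proof.
move=> n_gt0; case: (closed_rootP ('X^n - x%:P) _) => [|y].
  by rewrite size_XnsubC // eqSS -lt0n.
by rewrite /root !hornerE subr_eq0 => /eqP; exists y.
Qed.

Lemma linear_dependence (K : fieldType) (I J : finType) (B : I -> J -> K) :
  (#|J| < #|I|)%N ->
  exists2 b : I -> K, (exists i, b i != 0) & forall j, \sum_i b i * B i j = 0.
Proof.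
move=> hIJ; pose A := \matrix_(x < #|I|, y < #|J|) B (enum_val x) (enum_val y).
have : kermx A != 0.
  by rewrite kermx_eq0 -row_leq_rank -ltnNge (leq_ltn_trans (rank_leq_col A)).
rewrite -nz_row_eq0 => nz; set v := nz_row _ in nz.
have vA : v *m A = 0.
  by have /sub_kermxP := nz_row_sub (kermx A).
exists (fun i => v 0 (enum_rank i)) => [|j].
  have [i vi] := rV0Pn _ nz.
  by exists (enum_val i); rewrite enum_valK.
have := congr1 (fun M : 'rV_#|J| => M 0 (enum_rank j)) vA; rewrite !mxE => e; rewrite -[RHS]e.
rewrite (reindex (@enum_val I (mem I))) /=; last first.
  by exists enum_rank => x _; rewrite ?enum_valK ?enum_rankK.
by apply: eq_bigr => x _; rewrite mxE !enum_valK enum_rankK.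
Qed.

(** * Weights on polynomials in two variables *)

Section Weights.
Variables (K : fieldType) (Q d : nat).
Implicit Types h : {poly {poly K}}.

(* The outer variable is [Y], of weight [d]; the inner variable [X] has weight [Q]. *)
Definition wle h n := forall j i, (n < Q * i + d * j)%N -> h`_j`_i = 0.

Lemma wle_mono h m n : (m <= n)%N -> wle h m -> wle h n.
Proof. by move=> hmn hm j i hi; apply: hm; apply: leq_ltn_trans hi. Qed.

Lemma wle0 n : wle 0 n.
Proof. by move=> j i _; rewrite !coef0. Qed.

Lemma wleD h h' n : wle h n -> wle h' n -> wle (h + h') n.
Proof. by move=> a b j i l; rewrite !coefD a // b // addr0. Qed.

Lemma wleN h n : wle h n -> wle (- h) n.
Proof. by move=> a j i l; rewrite !coefN a // oppr0. Qed.

Lemma wle_sum (I : Type) (r : seq I) (P : pred I) (F : I -> {poly {poly K}}) n :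
  (forall i, P i -> wle (F i) n) -> wle (\sum_(i <- r | P i) F i) n.
Proof. move=> hF; apply: (big_ind (fun h => wle h n)) => [|h h'|//]; first exact: wle0.
exact: wleD. Qed.

Lemma wleM h h' m n : wle h m -> wle h' n -> wle (h * h') (m + n).
Proof.
move=> a b j i l; rewrite coefM coef_sum big1 // => x _.
rewrite coefM big1 // => y _; have hx := ltn_ord x; have hy := ltn_ord y.
case: (ltnP m (Q * y + d * x)) => [/a ->|h1]; first by rewrite mul0r.
rewrite [X in _ * X]b ?mulr0 //.
rewrite -(ltn_add2l m); apply: (leq_trans l).
have -> : (Q * i + d * j = (Q * y + d * x) + (Q * (i - y) + d * (j - x)))%N.
  by rewrite !mulnBr; have := leq_mul (leqnn Q) (hy : y <= i)%N; have := leq_mul (leqnn d) (hx : x <= j)%N; lia.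
by rewrite leq_add2r.
Qed.

Definition mon i j : {poly {poly K}} := ('X^i)%:P * 'X^j.

Lemma coef_mon i j b a : (mon i j)`_b`_a = ((a == i) && (b == j))%:R.
Proof.
by rewrite /mon coefCM coefXn; case: (b == j); rewrite ?mulr1 ?mulr0 ?coefXn ?coef0 ?andbT ?andbF.
Qed.

Lemma wle_mon i j n : (Q * i + d * j <= n)%N -> wle (mon i j) n.
Proof.
move=> hn b a hab; rewrite coef_mon; case: eqP => // ea; case: eqP => // eb.
by move: hn; rewrite -ea -eb leqNgt hab.
Qed.

Lemma wleC (c : K) : wle c%:P%:P 0.
Proof.
move=> j i hl; rewrite coefC; case: eqP => [ej|]; rewrite ?coef0 // coefC.
by case: eqP => // ei; move: hl; rewrite ei ej !muln0.
Qed.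

Lemma wleX h m k : wle h m -> wle (h ^+ k) (k * m).
Proof.
move=> hh; elim: k => [|k IH]; first by rewrite expr0 mul0n; have := wleC 1; rewrite !polyC1.
by rewrite exprS mulSn; apply: wleM.
Qed.

(* Substituting [X := t^Q], [Y := eta * t^d] turns the weight into the degree. *)
Definition Theta (eta : K) h : {poly K} :=
  (map_poly (comp_poly 'X^Q) h).[eta *: 'X^d].

HB.instance Definition _ eta := GRing.RMorphism.copy (Theta eta)
  (horner_eval (eta *: 'X^d) \o map_poly (comp_poly 'X^Q)).

Lemma ThetaB eta h h' : Theta eta (h - h') = Theta eta h - Theta eta h'.
Proof. exact: rmorphB. Qed.

Lemma ThetaM eta h h' : Theta eta (h * h') = Theta eta h * Theta eta h'.
Proof. exact: rmorphM. Qed.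

Lemma Theta_sum eta (I : finType) (F : I -> {poly {poly K}}) :
  Theta eta (\sum_i F i) = \sum_i Theta eta (F i).
Proof. exact: rmorph_sum. Qed.

Lemma ThetaX eta h n : Theta eta (h ^+ n) = Theta eta h ^+ n.
Proof. exact: rmorphXn. Qed.

Lemma Theta_mon eta i j : Theta eta (mon i j) = eta ^+ j *: 'X^(Q * i + d * j).
Proof.
rewrite /Theta /mon rmorphM /= map_polyC map_polyXn !hornerE /= comp_Xn_poly.
by rewrite exprZn -!exprM -scalerAr exprD.
Qed.

Lemma ThetaC eta c : Theta eta c%:P%:P = c%:P.
Proof. by rewrite /Theta map_polyC hornerC /= comp_polyC. Qed.

Lemma size_Theta eta h n : (0 < Q)%N -> wle h n -> (size (Theta eta h) <= n.+1)%N.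
Proof.
move=> Q0 hh; apply/leq_sizeP => N hN; rewrite /Theta horner_coef coef_sum big1 // => j _.
rewrite coef_map /= exprZn -exprM -scalerAr coefZ coefMXn.
case: ltnP => hj; first by rewrite mulr0.
rewrite coef_comp_poly_Xn //; case: ifP => [hd|]; last by rewrite mulr0.
by rewrite hh ?mulr0 // mulnC divnK // subnK.
Qed.

End Weights.

(** * Division by the equation of the curve *)

Section Reduction.
Variables (K : fieldType) (Q d : nat) (f : {poly K}).
Hypotheses (Q1 : (1 < Q)%N) (size_f : size f = d.+1) (d0 : (0 < d)%N).

Notation wle := (wle Q d).

Definition curve : {poly {poly K}} := 'X^Q - 'X - f%:P.

Lemma wle_curve : wle curve (Q * d).
Proof.
apply: wleD; [apply: wleD|]; rewrite ?wleN //.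
- have -> : 'X^Q = mon K 0 Q by rewrite /mon expr0 mul1r.
  by apply: wle_mon; rewrite muln0 add0n mulnC.
- apply: wleN; have -> : 'X = mon K 0 1 by rewrite /mon expr0 mul1r expr1.
  by apply: wle_mon; rewrite muln0 add0n muln1 leq_pmull // ltnW.
- apply: wleN => j i hl; rewrite coefC; case: eqP hl => [->|]; rewrite ?coef0 // muln0 addn0.
  by rewrite ltn_pmul2l ?(ltnW Q1) // => hi; rewrite nth_default // size_f.
Qed.

(** Long division in [Y]: cancelling a leading term [c Y^j] subtracts [c Y^(j-Q)] times the curve,
    which keeps the weight at most [n]. The bound on [q] adds [Q * d] instead of subtracting it from
    [n], so that it forces [q = 0] when [n < Q * d]. *)
Lemma curve_division w n : wle w n -> exists q r, [/\ w = q * curve + r,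
  forall j i, (n < Q * i + d * j + Q * d)%N -> q`_j`_i = 0, wle r n & (size r <= Q)%N].
Proof.
have [k] := ubnP (size w); elim: k w => // k IH w hk hw.
case: (leqP (size w) Q) => hQ.
  by exists 0, w; split => //; rewrite ?mul0r ?add0r // => j i _; rewrite !coef0.
set j := (size w).-1; have hj : (size w = j.+1)%N by rewrite /j prednK //; lia.
pose c := lead_coef w; pose t := c%:P * 'X^(j - Q).
have ht b a : (n < Q * a + d * b + Q * d)%N -> t`_b`_a = 0.
  rewrite /t coefCM coefXn; case: eqP => [->|_ _]; last by rewrite mulr0 coef0.
  rewrite mulr1 => hl; apply: hw; apply: (leq_trans hl).
  by rewrite mulnBr -addnA leq_add2l [(Q * d)%N]mulnC subnK // leq_mul2l -ltnS -hj hQ orbT.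
have wt : wle (t * curve) n.
  case: (leqP (Q * d) n) => hn.
    rewrite -(subnK hn); apply: wleM wle_curve => b a hl; apply: ht.
    by rewrite -(subnK hn) ltn_add2r.
  have -> : t = 0; last by rewrite mul0r; apply: wle0.
  by apply/polyP => b; apply/polyP => a; rewrite !coef0 ht // (leq_trans hn) ?leq_addl.
have hs : (size (w - t * curve)%R < size w)%N.
  have hle : (size (w - t * curve)%R <= j.+1)%N.
    apply: (leq_trans (size_polyD _ _)); rewrite geq_max hj leqnn size_polyN /=.
    apply: (leq_trans (size_polyMleq _ _)).
    have h1 : (size t <= (j - Q).+1)%N.
      by rewrite /t mul_polyC (leq_trans (size_scale_leq _ _)) // size_polyXn.
    have h2 : (size curve <= Q.+1)%N.
      apply: (leq_trans (size_polyD _ _)); rewrite geq_max size_polyN; apply/andP; split.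
        apply: (leq_trans (size_polyD _ _)).
        by rewrite geq_max size_polyXn size_polyN size_polyX leqnn ltnW.
      by rewrite (leq_trans (size_polyC_leq1 _)).
    by rewrite -subn1 leq_subLR; apply: (leq_trans (leq_add h1 h2)); lia.
  rewrite hj ltnS; apply/leq_sizeP => b; rewrite leq_eqVlt => /orP[/eqP <-|hb]; last first.
    by apply: (leq_sizeP _ _ hle).
  rewrite coefB /t -mulrA coefCM mulrC coefXnM ifF; last by lia.
  have -> : (j - (j - Q) = Q)%N by lia.
  rewrite /curve !coefB coefXn eqxx coefX coefC gtn_eqF // ifF; last by lia.
  by rewrite !subr0 mul1r /c lead_coefE subrr.
have [q [r [e hq hr sr]]] := IH _ (leq_trans hs (hk : size w <= k)%N) (wleD hw (wleN wt)).
exists (t + q), r; split => //; first by rewrite mulrDl -addrA -e addrC subrK.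
by move=> b a hl; rewrite !coefD ht // hq // addr0.
Qed.

(* Modulo terms of smaller weight, [Theta] kills [Y^Q - Y - f] because
   [eta^Q] is the leading coefficient of [f]. *)
Lemma remainder_neq0 eta w n q r : eta ^+ Q = f`_d -> w = q * curve + r ->
  (forall j i, (n < Q * i + d * j + Q * d)%N -> q`_j`_i = 0) ->
  (Theta Q d eta w)`_n != 0 -> r != 0.
Proof.
move=> heta -> hq; apply: contraNneq => ->; rewrite addr0.
have Q0 : (0 < Q)%N by apply: ltnW.
have [hn|hn] := leqP (Q * d) n; last first.
  have -> : q = 0; last by rewrite mul0r rmorph0 coef0.
  by apply/polyP => b; apply/polyP => a; rewrite !coef0 hq // (leq_trans hn) ?leq_addl.
have hsq : (size (Theta Q d eta q) <= (n - Q * d).+1)%N.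
  by apply: size_Theta => // b a hl; apply: hq; rewrite -(subnK hn) ltn_add2r.
have hsc : (size (Theta Q d eta curve) <= Q * d)%N.
  apply/leq_sizeP => b; rewrite leq_eqVlt => /orP[/eqP <-|hb]; last first.
    by apply: (leq_sizeP _ _ (size_Theta eta Q0 wle_curve)).
  have eQ : 'X^Q = mon K 0 Q by rewrite /mon expr0 mul1r.
  have e1 : Theta Q d eta 'X = Theta Q d eta (mon K 0 1).
    by rewrite /mon expr0 mul1r expr1.
  rewrite /curve !ThetaB eQ e1 !Theta_mon !muln0 !add0n muln1.
  rewrite !coefB !coefZ !coefXn mulnC eqxx mulr1 heta.
  have -> : (d * Q == d)%N = false by rewrite gtn_eqF // ltn_Pmulr.
  rewrite mulr0 subr0 /Theta map_polyC hornerC /= coef_comp_poly_Xn //.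
  by rewrite dvdn_mull // mulnK // subrr.
rewrite ThetaM; apply/eqP; apply: (leq_sizeP _ _ _) (leqnn n).
apply: (leq_trans (size_polyMleq _ _)); rewrite -subn1 leq_subLR.
by apply: (leq_trans (leq_add hsq hsc)); lia.
Qed.

End Reduction.

Lemma stepanov_weight s D t k : (t < s - D)%N -> (k < (s + D).+1)%N ->
  (t + D + s * (k + D) <= s ^ 2 + (2 * D + 1) * s)%N.
Proof.
move=> ht hk; have h : (s * (k + D) <= s * (s + 2 * D))%N by rewrite leq_mul2l; lia.
have -> : (s ^ 2 + (2 * D + 1) * s = s * (s + 2 * D) + s)%N by rewrite -mulnn; nia.
by rewrite addnC leq_add //; lia.
Qed.

(** * The auxiliary polynomial and the bound on the number of points *)

Section Stepanov.
Variables (K : closedFieldType) (Q s d : nat) (f : {poly K}) (C pts : seq K).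
Hypotheses (Q1 : (1 < Q)%N) (size_f : size f = d.+1) (d0 : (0 < d)%N).
Hypotheses (cQd : coprime d Q) (hQ : [pchar K].-nat Q) (hs : [pchar K].-nat s).
Hypotheses (uC : uniq C) (sC : size C = Q) (hC : forall c, c \in C -> c ^+ Q = c /\ c ^+ s = c).
Hypothesis upts : uniq pts.
Hypothesis hpts : forall x, x \in pts -> x ^+ (s ^ 2) = x /\
  exists2 y, y ^+ (s ^ 2) = y & y ^+ Q - y = f.[x].

Notation D := (Q * d)%N.
Hypothesis hsD : (D ^ 2 + 3 * D + 1 < s)%N.

Let Q0 : (0 < Q)%N. Proof. exact: ltnW. Qed.
Let s0 : (0 < s)%N. Proof. by apply: leq_trans hsD. Qed.

(* The exponents [(i, j)], [j < Q], of the monomial [X^i Y^j] of weight [t]: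
   they exist as soon as [t >= Q * d]. *)
Definition yexp t := (t * d ^ (totient Q).-1 %% Q)%N.
Definition xexp t := ((t - d * yexp t) %/ Q)%N.

(** By Euler's theorem [d ^ (totient Q).-1] is an inverse of [d] modulo [Q]. *)
Lemma mul_dinv t : t * d ^ (totient Q).-1 * d = t %[mod Q].
Proof.
rewrite -mulnA -expnSr prednK ?totient_gt0 //.
by rewrite -modnMmr Euler_exp_totient // modnMmr muln1.
Qed.

Lemma yexp_lt t : (yexp t < Q)%N. Proof. by rewrite /yexp ltn_mod. Qed.

Lemma yexpE i j : (j < Q)%N -> yexp (Q * i + d * j) = j.
Proof.
move=> hj; rewrite /yexp mulnDl -mulnA [(Q * _)%N]mulnC modnMDl.
by rewrite -mulnA mulnC mul_dinv modn_small.
Qed.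

Lemma wt_exp t : (D <= t)%N -> (Q * xexp t + d * yexp t)%N = t.
Proof.
move=> ht; have hd : (d * yexp t <= t)%N.
  by apply: leq_trans ht; rewrite mulnC leq_mul2r (ltnW (yexp_lt t)) orbT.
rewrite /xexp mulnC divnK ?subnK // -eqn_mod_dvd //.
by rewrite /yexp mulnC modnMml mul_dinv.
Qed.

Lemma xexpE i j : (j < Q)%N -> xexp (Q * i + d * j) = i.
Proof. by move=> hj; rewrite /xexp yexpE // addnK mulKn. Qed.

Let e t := mon K (xexp t) (yexp t).

Lemma wle_e t : (D <= t)%N -> wle Q d (e t) t.
Proof. by move=> ht; apply: wle_mon; rewrite wt_exp. Qed.

Let ev (x y : K) (h : {poly {poly K}}) : K := (map_poly (horner_eval x) h).[y].

Lemma evM x y h h' : ev x y (h * h') = ev x y h * ev x y h'.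
Proof. by rewrite /ev rmorphM hornerM. Qed.

Lemma evD x y h h' : ev x y (h + h') = ev x y h + ev x y h'.
Proof. by rewrite /ev rmorphD hornerD. Qed.

Lemma ev_sum x y (I : finType) (F : I -> {poly {poly K}}) :
  ev x y (\sum_i F i) = \sum_i ev x y (F i).
Proof. by rewrite /ev rmorph_sum horner_sum. Qed.

Lemma evX x y h n : ev x y (h ^+ n) = ev x y h ^+ n.
Proof. by rewrite /ev rmorphXn horner_exp. Qed.

Lemma evC x y c : ev x y c%:P%:P = c.
Proof. by rewrite /ev map_polyC hornerC /= /horner_eval hornerC. Qed.

Lemma evXn x y i : ev x y ('X^i)%:P = x ^+ i.
Proof. by rewrite /ev map_polyC hornerC /= /horner_eval hornerXn. Qed.

Lemma evY x y : ev x y 'X = y.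
Proof. by rewrite /ev map_polyX hornerX. Qed.

Lemma ev_e x y t : ev x y (e t) = x ^+ xexp t * y ^+ yexp t.
Proof. by rewrite evM evX evXn evY. Qed.

Lemma ev_curve x y : ev x y (curve Q f) = y ^+ Q - y - f.[x].
Proof.
by rewrite /ev /curve !rmorphB /= map_polyC map_polyXn map_polyX !hornerE /=.
Qed.

(** Up to a shift by [D], the pairs [(t, k)] with [D <= t < s] and [D <= k <= s + 2D]; from [D] on,
    a monomial of each weight exists. *)
Definition idx := ('I_(s - D) * 'I_(s + D).+1)%type.

Let te (x : idx) := (x.1 + D)%N.
Let ke (x : idx) := (x.2 + D)%N.
Let gen (x : idx) := e (te x) ^+ s * e (ke x).
Let N := (s ^ 2 + 2 * D)%N.

Lemma wle_gen x : wle Q d (gen x) N.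
Proof.
apply: (@wle_mono _ _ _ _ (s * te x + ke x)); last first.
  by apply: wleM; [apply: wleX|]; apply: wle_e; rewrite leq_addl.
rewrite /te /ke /N; case: x => [[t ht] [k hk]] /=.
have : (s * (t + D) <= s * (s - 1))%N by rewrite leq_mul2l; lia.
by rewrite mulnBr muln1 -mulnn; move: (leq_pmulr s s0); lia.
Qed.

(* There are more monomials [gen] than weights up to [N], and a reduced
   polynomial has at most one monomial of each weight. *)
Lemma stepanov_relation : exists b : idx -> K, (exists x, b x != 0) /\
  exists q, \sum_x (b x)%:P%:P * gen x = q * curve Q f.
Proof.
have hg x : exists qr : {poly {poly K}} * {poly {poly K}},
    [/\ gen x = qr.1 * curve Q f + qr.2, wle Q d qr.2 N & (size qr.2 <= Q)%N].
  have [q [r [h1 h2 h3 h4]]] := curve_division Q1 size_f d0 (wle_gen x).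
  by exists (q, r).
have [qr hqr] := fin_all_exists hg.
pose B (x : idx) (t : 'I_N.+1) := (qr x).2`_(yexp t)`_(xexp t).
(* There are [s^2 + s - D^2 - D] pairs and [s^2 + 2D + 1] weights; [hsD] says exactly that the pairs
   are more numerous. *)
have hcard : (#|'I_N.+1| < #|{: idx}|)%N.
  rewrite card_prod !card_ord /N; have hD : (D <= s)%N by move: hsD; rewrite -mulnn; lia.
  have -> : ((s - D) * (s + D).+1 = s ^ 2 + s - (D ^ 2 + D))%N.
    by rewrite -addn1 mulnDr muln1 -subn_sqr; have := leq_sqr D s; rewrite hD; lia.
  by move: hsD; have := leq_sqr D s; rewrite hD; lia.
have [b hb hB] := linear_dependence B hcard.
exists b; split => //; exists (\sum_x (b x)%:P%:P * (qr x).1).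
have hz : \sum_x (b x)%:P%:P * (qr x).2 = 0.
  apply/polyP => j; apply/polyP => i; rewrite !coef0 !coef_sum.
  have hc x : ((b x)%:P%:P * (qr x).2)`_j`_i = b x * (qr x).2`_j`_i by rewrite !coefCM.
  under eq_bigr do rewrite hc.
  case: (ltnP j Q) => hj; last first.
    rewrite big1 // => x _; have [_ _ hx] := hqr x.
    by rewrite (leq_sizeP _ _ hx) // coef0 mulr0.
  case: (ltnP N (Q * i + d * j)%N) => hN.
    by rewrite big1 // => x _; have [_ hx _] := hqr x; rewrite hx // mulr0.
  rewrite -[RHS](hB (inord (Q * i + d * j))); apply: eq_bigr => x _.
  by rewrite /B inordK ?ltnS // yexpE // xexpE.
rewrite mulr_suml -[RHS]addr0 -[X in _ = _ + X]hz -big_split; apply: eq_bigr => x _ /=.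
by have [-> _ _] := hqr x; rewrite mulrDr mulrA.
Qed.

(* On rational points [e_k^(s^2) = e_k], so the [s]-th power of the auxiliary
   polynomial equals [sum b_z gen z] there. *)
Lemma pts_Frob x y (b : idx -> K) (a : idx -> K) : (forall z, a z ^+ s = b z) ->
  x ^+ (s ^ 2) = x -> y ^+ (s ^ 2) = y -> y ^+ Q - y = f.[x] ->
  (exists q, \sum_z (b z)%:P%:P * gen z = q * curve Q f) ->
  ev x y (\sum_z (a z)%:P%:P * e (te z) * e (ke z) ^+ s) = 0.
Proof.
move=> hab hx hy hc [q hq]; apply/eqP.
have : ev x y (\sum_z (a z)%:P%:P * e (te z) * e (ke z) ^+ s) ^+ s == 0.
  rewrite ev_sum expr_sum_pchar //.
  have -> : \sum_z ev x y ((a z)%:P%:P * e (te z) * e (ke z) ^+ s) ^+ s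
          = ev x y (\sum_z (b z)%:P%:P * gen z).
    rewrite ev_sum; apply: eq_bigr => z _.
    rewrite [RHS]evM evC [ev x y (gen z)]evM evX evM evM evC evX !ev_e.
    rewrite !exprMn hab -!mulrA. congr (_ * (_ * (_ * _))).
    by rewrite -!exprM mulnn ![(_ * s ^ 2)%N]mulnC [x ^+ _]exprM [y ^+ (_ * yexp _)]exprM hx hy.
  by rewrite hq evM ev_curve hc subrr mulr0.
by rewrite expf_eq0 => /andP[_].
Qed.

(** The polynomial [W] takes [s]-th roots of the coefficients of the relation and moves the exponent
    [s] from [e_t] to [e_k]; it vanishes at the points because its [s]-th power does. Its remainder
    [r] modulo the curve is nonzero of degree less than [Q] in [Y], while the [Q] points [y + c] lie
    above each [x]. Hence all coefficients of [r] vanish on [pts], and the weight bounds their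
    degrees. *)
Lemma stepanov : (Q * size pts <= s ^ 2 + (2 * D + 1) * s)%N.
Proof.
have [b [[x0 hx0] hq]] := stepanov_relation.
have ha x : exists y, y ^+ s = b x by apply: closed_nth_root.
have [a hab] := fin_all_exists ha.
have hx0' : a x0 != 0 by apply: contraNneq hx0 => h; rewrite -hab h expr0n gtn_eqF.
pose W := \sum_z (a z)%:P%:P * e (te z) * e (ke z) ^+ s.
pose w (x : idx) := (te x + s * ke x)%N.
have [x1 hx1 hmax] := @arg_maxnP _ x0 (fun x => a x != 0) w hx0'; set n := w x1 in hmax.
have te_s (x : idx) : (te x < s)%N.
  by rewrite /te; have := ltn_ord x.1; lia.
(* The indices [te x < s] and [ke x] are the remainder and the quotient of the weight by [s]:
   distinct terms of [W] have distinct weights, so the top one cannot cancel. *)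
have w_inj : injective w.
  move=> x y hxy; have := congr1 (fun t => t %% s)%N hxy; have := congr1 (fun t => t %/ s)%N hxy.
  rewrite /w -![(te _ + _)%N]addnC ![(s * _)%N]mulnC !divnMDl // !modnMDl !(divn_small (te_s _)) !addn0.
  rewrite !(modn_small (te_s _)) /ke /te => /addIn/val_inj e2 /addIn/val_inj e1.
  by rewrite [x]surjective_pairing [y]surjective_pairing e1 e2.
have wW : wle Q d W n.
  apply: wle_sum => x _; have [->|nz] := eqVneq (a x) 0; first by rewrite !polyC0 !mul0r; apply: wle0.
  apply: (wle_mono (hmax x nz)); rewrite /w -[te x]add0n.
  apply: wleM; [apply: wleM; [apply: wleC|]|apply: wleX]; apply: wle_e; exact: leq_addl.
have [eta heta] := closed_nth_root f`_d Q0.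
have eta0 : eta != 0.
  apply: contraTneq isT => h; move: heta; rewrite h expr0n gtn_eqF // => /esym/eqP.
  by rewrite -[d]/(d.+1.-1) -size_f -lead_coefE lead_coef_eq0 -size_poly_eq0 size_f.
have topW : (Theta Q d eta W)`_n != 0.
  have eW : Theta Q d eta W = \sum_x (a x * eta ^+ (yexp (te x) + yexp (ke x) * s)) *: 'X^(w x).
    rewrite /W Theta_sum; apply: eq_bigr => x _.
    rewrite 2!ThetaM ThetaC ThetaX !Theta_mon !wt_exp ?leq_addl // exprZn -!exprM.
    by rewrite mul_polyC scalerA -scalerAl -scalerAr scalerA -exprD [in RHS]exprD mulrA [(ke x * s)%N]mulnC.
  rewrite eW coef_sum (bigD1 x1) //= big1 => [|x hx]; last first.
    rewrite coefZ coefXn; have -> : (n == w x) = false; last by rewrite mulr0.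
    by apply/negbTE; apply: contraNneq hx => h; apply/eqP/w_inj; rewrite -h.
  by rewrite addr0 coefZ coefXn eqxx mulr1 mulf_neq0 // expf_neq0.
have [q [r [eqW hq' hr sr]]] := curve_division Q1 size_f d0 wW.
have r0 := remainder_neq0 Q1 size_f d0 heta eqW hq' topW.
have hvan x j : x \in pts -> root r`_j x.
  move=> hx; have [xs [y ys hy]] := hpts hx.
  have : map_poly (horner_eval x) r = 0.
    apply: (@roots_geq_poly_eq0 _ _ [seq y + c | c <- C]).
    - apply/allP => _ /mapP[c hcC ->]; have [cQ cs] := hC hcC.
      have cs2 : c ^+ (s ^ 2) = c by rewrite expnS expn1 exprM !cs.
      have ys2 : (y + c) ^+ (s ^ 2) = y + c.
        by rewrite exprDn_pchar ?ys ?cs2 // pnatX hs.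
      have yc : (y + c) ^+ Q - (y + c) = f.[x].
        by rewrite exprDn_pchar // cQ -hy; ring.
      have := pts_Frob hab xs ys2 yc hq; rewrite -/W eqW evD evM ev_curve yc subrr mulr0 add0r.
      by move/eqP.
    - by rewrite map_inj_uniq //; apply: addrI.
    by rewrite size_map sC (leq_trans (size_poly _ _)).
  move/polyP/(_ j); rewrite coef_map coef0 => /eqP; exact.
have [j hj] : exists j, r`_j != 0.
  by exists (size r).-1; rewrite -lead_coefE lead_coef_eq0.
have hsize : (size pts < size (r`_j)%R)%N.
  by apply: max_poly_roots => //; apply/allP => x; apply: hvan.
set i := (size (r`_j)%R).-1.
have hi : (Q * i + d * j <= n)%N.
  rewrite leqNgt; apply: contra hj => /hr; rewrite /i -lead_coefE => /eqP.
  by rewrite lead_coef_eq0.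
have hn : (n <= s ^ 2 + (2 * D + 1) * s)%N.
  exact: (stepanov_weight (ltn_ord x1.1) (ltn_ord x1.2)).
apply: leq_trans hn; apply: leq_trans hi.
apply: (@leq_trans (Q * i)); last exact: leq_addr.
by rewrite leq_mul2l -ltnS prednK ?hsize ?orbT // (leq_ltn_trans _ hsize).
Qed.

End Stepanov.

(** * Additive characters and exponential sums *)

Definition addchar (V : zmodType) (chi : V -> algC) :=
  chi 0 = 1 /\ forall x y, chi (x + y) = chi x * chi y.

Section AddChar.
Variables (V : zmodType) (chi : V -> algC).
Hypothesis hchi : addchar chi.

Lemma addchar_sum (I : Type) (r : seq I) (P : pred I) (G : I -> V) :
  chi (\sum_(i <- r | P i) G i) = \prod_(i <- r | P i) chi (G i).
Proof. by case: hchi => h0 hD; apply: (big_morph chi hD h0). Qed.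

Lemma addcharMn x n : chi (x *+ n) = chi x ^+ n.
Proof.
case: hchi => h0 hD; elim: n => [|n IH]; first by rewrite mulr0n expr0.
by rewrite mulrS exprS hD IH.
Qed.

Lemma addcharN x : chi (- x) * chi x = 1.
Proof. by case: hchi => h0 hD; rewrite -hD addNr. Qed.

End AddChar.

Lemma sum_addchar_eq0 (V : finZmodType) (chi : V -> algC) :
  addchar chi -> (exists x, chi x != 1) -> \sum_x chi x = 0.
Proof.
move=> [h0 hD] [x hx]; have : chi x * (\sum_y chi y) = \sum_y chi y.
  rewrite mulr_sumr [RHS](reindex_inj (addrI x)).
  by apply: eq_bigr => y _; rewrite hD.
move/eqP; rewrite -subr_eq0 -{2}[\sum_y _]mul1r -mulrBl mulf_eq0 subr_eq0 (negPf hx).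
by move/eqP.
Qed.

Lemma sum_addchar (V : finZmodType) (chi : V -> algC) : addchar chi ->
  \sum_x chi x = 0 \/ \sum_x chi x = #|V|%:R.
Proof.
move=> hchi; have [/existsP hx|/existsPn hx] := boolP [exists x, chi x != 1].
  by left; apply: sum_addchar_eq0.
right; rewrite (eq_bigr (fun _ => 1)) => [|x _]; last by apply/eqP/negPn/hx.
by rewrite sumr_const.
Qed.

(** * Finite fields inside an algebraically closed field; traces and exponential sums *)

Section FiniteFields.
Variables (F : finFieldType) (K : closedFieldType) (emb : {rmorphism F -> K}).

Notation Q := #|F|.

Lemma card_gt1 : (1 < Q)%N. Proof. exact: finNzRing_gt1. Qed.

Lemma card_pnat : [pchar K].-nat Q.
Proof.
have [p p_pr pF] := finPcharP F.
have pK : p \in [pchar K] by rewrite (fmorph_pchar emb).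
rewrite (eq_pnat _ (pcharf_eq pK)).
have := pprimeChar_pgroup pF; rewrite /pgroup.
by have -> : #|[set: pPrimeCharType pF]| = Q by rewrite cardsT.
Qed.

Lemma cardX_pnat n : [pchar K].-nat (Q ^ n)%N.
Proof. by rewrite pnatX card_pnat. Qed.

Lemma card_natr0 : Q%:R = 0 :> K.
Proof.
have [p p_pr pF] := finPcharP F.
have pK : p \in [pchar K] by rewrite (fmorph_pchar emb).
apply/eqP; rewrite -(dvdn_pcharf pK).
have := card_pnat; rewrite (eq_pnat _ (pcharf_eq pK)) => /p_natP [k hk].
by rewrite hk dvdn_exp //; have := card_gt1; rewrite hk; case: k {hk}.
Qed.

Lemma emb_Frob c n : emb c ^+ (Q ^ n) = emb c.
Proof.
elim: n => [|n IH]; first by rewrite expn0 expr1.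
by rewrite expnS exprM -rmorphXn expf_card.
Qed.

Lemma emb_fixed z : z ^+ Q = z -> exists c, z = emb c.
Proof.
move=> hz; have := congr1 (fun P => (map_poly emb P).[z]) (finField_genPoly F).
rewrite rmorphB /= map_polyXn map_polyX !hornerE hz subrr rmorph_prod horner_prod.
move/esym/eqP/prodf_eq0 => [c _].
by rewrite rmorphB /= map_polyX map_polyC !hornerE subr_eq0 => /eqP; exists c.
Qed.

(* The subfield of [K] with [Q ^ r] elements, for [r > 0]. *)
Definition Fix r : seq K := sval (closed_field_poly_normal ('X^(Q ^ r) - 'X)).

Lemma FixE r : (0 < r)%N -> 'X^(Q ^ r) - 'X = \prod_(z <- Fix r) ('X - z%:P).
Proof.
move=> hr; rewrite /Fix; case: closed_field_poly_normal => xs /= {1}->.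
have h : (1 < Q ^ r)%N by rewrite -(exp1n r) ltn_exp2r // card_gt1.
rewrite lead_coefDl ?lead_coefXn ?scale1r // size_polyN size_polyX size_polyXn.
by rewrite ltnS.
Qed.

Lemma mem_Fix r z : (0 < r)%N -> (z \in Fix r) = (z ^+ (Q ^ r) == z).
Proof.
by move=> hr; rewrite -root_prod_XsubC -FixE // /root !hornerE subr_eq0.
Qed.

Lemma FixP r z : (0 < r)%N -> z \in Fix r -> z ^+ (Q ^ r) = z.
Proof. by move=> hr; rewrite mem_Fix // => /eqP. Qed.

Lemma size_Fix r : (0 < r)%N -> size (Fix r) = (Q ^ r)%N.
Proof.
move=> hr; have := congr1 (fun P : {poly K} => size P) (FixE hr).
have h : (1 < Q ^ r)%N by rewrite -(exp1n r) ltn_exp2r // card_gt1.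
by rewrite size_prod_XsubC size_polyDl ?size_polyXn => [[]//|]; rewrite size_polyN size_polyX.
Qed.

Lemma uniq_Fix r : (0 < r)%N -> uniq (Fix r).
Proof.
move=> hr; rewrite -separable_prod_XsubC -FixE // unlock derivB derivXn derivX.
have -> : 'X^((Q ^ r).-1) *+ (Q ^ r) = 0 :> {poly K}.
  by rewrite -mulr_natr -polyC_natr natrX card_natr0 expr0n gtn_eqF // mulr0.
by rewrite sub0r -[X in coprimep _ X]scaleN1r coprimepZr ?coprimep1 // oppr_eq0 oner_eq0.
Qed.

Lemma horner_Frob (f : {poly F}) x n :
  (map_poly emb f).[x] ^+ (Q ^ n) = (map_poly emb f).[x ^+ (Q ^ n)].
Proof.
rewrite !horner_coef expr_sum_pchar ?cardX_pnat //; apply: eq_bigr => i _.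
by rewrite exprMn coef_map /= emb_Frob -!exprM mulnC.
Qed.

Lemma horner_Fix (f : {poly F}) x r : (0 < r)%N -> x \in Fix r ->
  (map_poly emb f).[x] \in Fix r.
Proof. by move=> hr hx; rewrite mem_Fix // horner_Frob FixP. Qed.

Definition Ktrace r (z : K) := \sum_(i < r) z ^+ (Q ^ i).

(** For [z] fixed by the [Q^r]-power map the choice succeeds, by [emb_Ftrace]; the default 0
    concerns other [z] only. *)
Definition Ftrace r z : F := odflt 0 [pick c | emb c == Ktrace r z].

(** Telescoping. It shows both that traces from the subfield land in [F] and that a solution of
    [y^Q - y = z] lies in the subfield when [z] has trace 0. *)
Lemma Ktrace_Frob r z : Ktrace r z ^+ Q - Ktrace r z = z ^+ (Q ^ r) - z.
Proof.
rewrite /Ktrace expr_sum_pchar ?card_pnat //.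
elim: r => [|r IH]; first by rewrite !big_ord0 expn0 expr1 !subrr.
by rewrite !big_ord_recr /= -exprM -expnSr opprD addrACA IH; ring.
Qed.

Lemma emb_Ftrace r z : z ^+ (Q ^ r) = z -> emb (Ftrace r z) = Ktrace r z.
Proof.
move=> hz; rewrite /Ftrace; case: pickP => [c /eqP //|h].
have /emb_fixed[c hc] : Ktrace r z ^+ Q = Ktrace r z.
  by apply/eqP; rewrite -subr_eq0 Ktrace_Frob hz subrr.
by have := h c; rewrite hc eqxx.
Qed.

Lemma KtraceB r x y : Ktrace r (x - y) = Ktrace r x - Ktrace r y.
Proof.
by rewrite /Ktrace -sumrB; apply: eq_bigr => i _; rewrite exprB_pchar ?cardX_pnat.
Qed.

Lemma KtraceD r x y : Ktrace r (x + y) = Ktrace r x + Ktrace r y.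
Proof.
by rewrite /Ktrace -big_split; apply: eq_bigr => i _; rewrite exprDn_pchar ?cardX_pnat.
Qed.

Variable psi : F -> algC.
Hypothesis hpsi : addchar psi.
Hypothesis psi_neq1 : exists c, psi c != 1.

Lemma addchar_norm c : `|psi c| = 1.
Proof.
have [p p_pr pF] := finPcharP F.
apply/eqP; rewrite -(@eqrXn2 _ p) ?prime_gt0 // -normrX -addcharMn //.
by rewrite (mulrn_pchar pF); case: hpsi => -> _; rewrite normr1 expr1n.
Qed.

Lemma addchar_conj c : (psi c)^* = psi (- c).
Proof.
rewrite -[LHS]mul1r -(addcharN hpsi c) -mulrA -normCK addchar_norm expr1n.
by rewrite mulr1.
Qed.

Definition expsum (f : {poly F}) r : algC :=
  \sum_(x <- Fix r) psi (Ftrace r (map_poly emb f).[x]).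

Section Bound.
Variables (f : {poly F}) (d a : nat).
Hypotheses (size_f : size f = d.+1) (d0 : (0 < d)%N) (cd : coprime d Q).
Notation D := (Q * d)%N.
Notation s := (Q ^ a)%N.
Hypothesis hs : (D ^ 2 + 3 * D + 1 < s)%N.
Let r := (2 * a)%N.
Let fx x := (map_poly emb f).[x].
Let N c := size [seq x <- Fix r | Ftrace r (fx x) == c].

Let a0 : (0 < a)%N. Proof. by case: a hs => // h; move: h; rewrite expn0 ltnS leqn0 addn1. Qed.
Let r0 : (0 < r)%N. Proof. by rewrite /r muln_gt0 a0. Qed.
Let s2 : (s ^ 2)%N = (Q ^ r)%N. Proof. by rewrite -expnM mulnC. Qed.

(** Fix a point [x1] of the level set. For each [x] in it [f(x) - f(x1)] has trace 0, hence equals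
    [y^Q - y] with [y] in the field of [s^2] elements (additive Hilbert 90), and [stepanov] applies
    to [f - f(x1)]. *)
Lemma level_bound c : (Q * N c <= s ^ 2 + (2 * D + 1) * s)%N.
Proof.
rewrite /N; case E : [seq x <- Fix r | Ftrace r (fx x) == c] => [|x1 xs].
  by rewrite muln0.
rewrite -E; have : x1 \in [seq x <- Fix r | Ftrace r (fx x) == c].
  by rewrite E inE eqxx.
rewrite mem_filter => /andP[/eqP h1 /(FixP r0) hx1] {E}.
have fix_fx x : x ^+ (Q ^ r) = x -> fx x ^+ (Q ^ r) = fx x.
  by move=> hx; rewrite /fx horner_Frob hx.
apply: (@stepanov K Q s d (map_poly emb f - (fx x1)%:P) [seq emb c | c <- enum F]) => //.
- exact: card_gt1.
- rewrite size_polyDl ?size_map_poly // size_polyN size_f.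
  by rewrite (leq_ltn_trans (size_polyC_leq1 _)).
- exact: card_pnat.
- exact: cardX_pnat.
- by rewrite map_inj_uniq ?enum_uniq //; apply: fmorph_inj.
- by rewrite size_map -cardE.
- move=> _ /mapP[b _ ->]; split; last exact: emb_Frob.
  by have := emb_Frob b 1; rewrite expn1.
- by rewrite filter_uniq // uniq_Fix.
move=> x; rewrite mem_filter => /andP[/eqP hx /(FixP r0) hxr].
rewrite s2; split => //.
set z := (map_poly emb f - (fx x1)%:P).[x].
have ez : z = fx x - fx x1 by rewrite /z !hornerE.
have zr : Ktrace r z = 0.
  by rewrite ez KtraceB -!emb_Ftrace ?fix_fx // hx h1 subrr.
case: (closed_rootP ('X^Q - ('X + z%:P)) _) => [|y].
  rewrite size_polyDl size_polyXn ?eqSS ?gtn_eqF ?ltnS // ?(ltnW card_gt1) //.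
  by rewrite size_polyN size_XaddC card_gt1.
rewrite /root !hornerE subr_eq0 => /eqP hy; exists y; last by rewrite hy; ring.
apply/eqP; rewrite -subr_eq0 -Ktrace_Frob -zr.
have -> : z = y ^+ Q - y by rewrite hy; ring.
by rewrite KtraceB /Ktrace expr_sum_pchar ?card_pnat //; under eq_bigr do rewrite exprAC.
Qed.

(* The upper bounds on all the level sets of the trace, whose sizes add up to
   [s ^ 2], are enough: [expsum] is minus the sum of the defects. *)
Lemma expsum_bound : `|expsum f r| <= ((2 * D + 1) * s)%:R.
Proof.
have hN : (\sum_c N c = s ^ 2)%N.
  rewrite s2 -size_Fix // /N -sum1_size (partition_big (fun x => Ftrace r (fx x)) predT) //=.
  by apply: eq_bigr => c _; rewrite size_filter -sum1_count.
set U := (s ^ 2 + (2 * D + 1) * s)%N.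
(* The values of [psi] sum to 0, so the constant [U] may be subtracted from every [Q * N c]. The
   differences then have a single sign, and their absolute values add up to [Q (U - s^2)]. *)
have hS : expsum f r * Q%:R = - \sum_c (U - Q * N c)%:R * psi c.
  have -> : expsum f r = \sum_c (N c)%:R * psi c.
    rewrite /expsum (partition_big (fun x => Ftrace r (fx x)) predT) //=.
    apply: eq_bigr => c _; rewrite (eq_bigr (fun _ => psi c)) => [|x /eqP -> //].
    by rewrite big_const_seq iter_addr_0 /N size_filter mulr_natl.
  under [X in - X]eq_bigr => c _ do rewrite natrB ?level_bound // mulrBl.
  rewrite sumrB -mulr_sumr (sum_addchar_eq0 hpsi psi_neq1) mulr0 sub0r opprK mulr_suml.
  by apply: eq_bigr => c _; rewrite natrM mulrAC [Q%:R * _]mulrC.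
have Q0 : 0 < Q%:R :> algC by rewrite ltr0n (ltnW card_gt1).
rewrite -(ler_pM2r Q0) -[X in _ * X <= _]normr_nat -normrM hS normrN.
apply: (le_trans (ler_norm_sum _ _ _)).
under eq_bigr do rewrite normrM addchar_norm mulr1 normr_nat.
rewrite -natr_sum -natrM ler_nat sumnB => [|c _]; last exact: level_bound.
by rewrite -big_distrr /= hN sum_nat_const /U mulnDr addKn mulnC.
Qed.

End Bound.
End FiniteFields.

(** * The L-function of an additive character *)

Section LambdaChar.
Variables (F : finFieldType) (psi : F -> algC) (f : {poly F}) (n : nat).
Hypothesis hpsi : addchar psi.
Hypothesis psi_neq1 : exists c, psi c != 1.
Notation d := n.+1.
Implicit Types A B : {poly F}.
Hypothesis fd0 : f`_d *+ d != 0.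

(** For [A = prod (1 - x X)] and [f_0 = 0] this is the sum of the [f(x)], expressed by the
    coefficients of [A] alone. *)
Definition flog (A : {poly F}) : F := \sum_(j < d.+1) f`_j * psum A j.

Definition Lam A := psi (flog A).

Lemma flogM A B : A`_0 = 1 -> B`_0 = 1 -> flog (A * B) = flog A + flog B.
Proof.
move=> A0 B0; rewrite /flog -big_split; apply: eq_bigr => j _.
by rewrite psumM // mulrDr.
Qed.

Lemma LamM A B : A`_0 = 1 -> B`_0 = 1 -> Lam (A * B) = Lam A * Lam B.
Proof. by move=> A0 B0; rewrite /Lam flogM //; case: hpsi => _ ->. Qed.

Lemma flog1 : flog 1 = 0.
Proof.
have := flogM (coef1 _ 0) (coef1 _ 0); rewrite mulr1 => /eqP.
by rewrite -subr_eq0 opprD addrA subrr sub0r oppr_eq0 => /eqP.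
Qed.

Lemma eq_flog A B : A`_0 = 1 -> (forall i, (i <= d)%N -> A`_i = B`_i) ->
  flog A = flog B.
Proof.
move=> A0 e; apply: eq_bigr => j _; congr (_ * _).
by apply: (eq_psum A0 e); rewrite -ltnS.
Qed.

Lemma flog_addX A c : A`_0 = 1 -> flog (A + c *: 'X^d) = flog A - f`_d *+ d * c.
Proof.
move=> A0; have ed := psum_addX c A0 (ltn0Sn n).
set B := A + _ in ed *; rewrite /flog big_ord_recr [in RHS]big_ord_recr /=.
rewrite ed mulrBr addrA mulrnAr mulrnAl; congr (_ + _ - _).
apply: eq_bigr => j _; congr (_ * _); have hj := ltn_ord j.
have hX i : (i <= n)%N -> B`_i = A`_i.
  by move=> hi; rewrite coefD coefZ coefXn ltn_eqF ?ltnS // mulr0 addr0.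
by apply: (eq_psum (d := n)); rewrite ?hX // -ltnS.
Qed.

(* The monic polynomial of degree [k] with roots [x] corresponds to
   [prod (1 - x X)]: the Dirichlet coefficients are indexed by the latter. *)
Definition Apol k (v : 'rV[F]_k) : {poly F} := 1 + 'X * rVpoly v.

Lemma Apol0 k (v : 'rV[F]_k) : (Apol v)`_0 = 1.
Proof. by rewrite coefD coef1 coefXM addr0. Qed.

Lemma ApolS k (v : 'rV[F]_k) (i : 'I_k) : (Apol v)`_i.+1 = v 0 i.
Proof.
by rewrite coefD coef1 coefXM add0r /= coef_rVpoly_ord.
Qed.

Lemma Apol_big k (v : 'rV[F]_k) i : (k < i)%N -> (Apol v)`_i = 0.
Proof.
case: i => // i hi; rewrite coefD coef1 coefXM add0r /= coef_rVpoly.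
by case: insubP => //= j hj; rewrite ltnNge hj in hi.
Qed.

Definition csum k : algC := \sum_(v : 'rV[F]_k) Lam (Apol v).

Lemma csum0 : csum 0 = 1.
Proof.
rewrite /csum (eq_bigr (fun _ => 1)) => [|v _].
  by rewrite sumr_const card_mx mul1n expn0.
rewrite /Lam; have -> : Apol v = 1.
  apply/polyP => -[|i]; first by rewrite Apol0 coef1.
  by rewrite Apol_big // coef1.
by rewrite flog1; case: hpsi.
Qed.

Lemma psi_scale_neq1 u : u != 0 -> exists c, psi (u * c) != 1.
Proof.
move=> hu; have [c hc] := psi_neq1.
by exists (u^-1 * c); rewrite mulrA mulfV // mul1r.
Qed.

(** Once the coefficient of [X^d] is free, shifting it permutes the terms and multiplies each by the
    same value of [psi], which a suitable shift makes different from 1. *)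
Lemma csum_eq0 k : (d <= k)%N -> csum k = 0.
Proof.
move=> hk; pose j := Ordinal hk.
have [|a ha] := @psi_scale_neq1 (- (f`_d *+ d)); first by rewrite oppr_eq0.
have : psi (- (f`_d *+ d) * a) * csum k = csum k.
  rewrite /csum mulr_sumr [RHS](reindex_inj (addrI (a *: delta_mx 0 j))).
  apply: eq_bigr => v _; rewrite /Lam; have -> : Apol (a *: delta_mx 0 j + v) = Apol v + a *: 'X^d.
    apply/polyP => -[|i]; first by rewrite coefD !Apol0 coefZ coefXn mulr0 addr0.
    case: (ltnP i k) => hi; last first.
      rewrite coefD !Apol_big // coefZ coefXn gtn_eqF ?mulr0 ?addr0 //.
      by rewrite ltnS (leq_trans hk).
    rewrite -[i]/(val (Ordinal hi)) coefD !ApolS coefZ coefXn !mxE /= eqSS.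
    by rewrite -val_eqE /= addrC.
  by rewrite flog_addX ?Apol0 // mulNr; case: hpsi => _ ->; rewrite mulrC.
move/eqP; rewrite -subr_eq0 -{2}[csum k]mul1r -mulrBl mulf_eq0 subr_eq0 (negPf ha).
by move/eqP.
Qed.

Lemma coef_ApolM (v w : 'rV[F]_n) :
  (Apol v * Apol w)`_d = \sum_(i < n) v 0 i * w 0 (rev_ord i).
Proof.
rewrite coefM big_ord_recl big_ord_recr /= subn0 subnn.
rewrite /bump /= add1n !Apol0 !Apol_big // mulr0 mul0r add0r addr0.
apply: eq_bigr => i _; rewrite add1n ApolS; congr (_ * _).
have -> : (n.+1 - i.+1 = (rev_ord i).+1)%N by rewrite /= subSS; have := ltn_ord i; lia.
by rewrite ApolS.
Qed.

(* [Lam] is a character of the truncated unit group [(1 + u F[u]) / u^(d+1)]; the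
   top coefficient of a product of two elements of degree [< d] is a perfect
   pairing, so the double sum [|csum n|^2] collapses by orthogonality. *)
Lemma csum_norm : `|csum n| ^+ 2 = (#|F| ^ n)%:R.
Proof.
rewrite normCK /csum rmorph_sum mulr_sumr.
under eq_bigr do rewrite mulr_suml.
have step (w : 'rV[F]_n) :
    \sum_(v : 'rV[F]_n) Lam (Apol v) * (Lam (Apol w))^*
  = \sum_(v : 'rV[F]_n) Lam (Apol v) * psi (f`_d *+ d * (Apol v * Apol w)`_d).
  (* [t v] records the coefficients of the product in degrees 1 to [n]. A factor of constant term 1
     is invertible modulo [X^(n+1)], so [t] is a permutation; the lost coefficient of [X^d] is
     accounted for by the extra value of [psi]. *)
  pose t (v : 'rV[F]_n) := \row_(i < n) (Apol v * Apol w)`_i.+1.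
  have coef_t v i : (i <= n)%N -> (Apol (t v))`_i = (Apol v * Apol w)`_i.
    case: i => [|i] hi; first by rewrite coefM big_ord1 !Apol0 mulr1.
    by rewrite -[i]/(val (Ordinal hi)) ApolS mxE.
  have t_inj : injective t.
    move=> v v' e; have h i : (i <= n)%N -> (Apol v)`_i = (Apol v')`_i.
      elim/ltn_ind: i => i IH hi.
      have : (Apol v * Apol w)`_i = (Apol v' * Apol w)`_i by rewrite -!coef_t // e.
      rewrite !coefM !big_ord_recr /= subnn !Apol0 !mulr1.
      rewrite [X in X + _ = _](_ : _ = \sum_(j < i) (Apol v')`_j * (Apol w)`_(i - j)).
        by move/addrI.
      by apply: eq_bigr => j _; rewrite IH // (leq_trans (ltnW (ltn_ord j))).
    by apply/rowP => i; rewrite -!ApolS h.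
  rewrite (reindex_inj t_inj); apply: eq_bigr => v _.
  have -> : Lam (Apol (t v)) = Lam (Apol v) * Lam (Apol w) * psi (f`_d *+ d * (Apol v * Apol w)`_d).
    rewrite -LamM ?Apol0 // /Lam; case: hpsi => _ <-; congr psi.
    rewrite (@eq_flog (Apol v * Apol w) (Apol (t v) + (Apol v * Apol w)`_d *: 'X^d)).
    - by rewrite flog_addX ?Apol0 // subrK.
    - by rewrite coefM big_ord1 !Apol0 mulr1.
    move=> i; rewrite leq_eqVlt => /orP[/eqP ->|hi].
      by rewrite coefD Apol_big // coefZ coefXn eqxx mulr1 add0r.
    by rewrite coefD coef_t // coefZ coefXn ltn_eqF // mulr0 addr0.
  rewrite addchar_conj // -[RHS]mulr1 -(addcharN hpsi (flog (Apol w))) /Lam; ring.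
rewrite (eq_bigr _ (fun w _ => step w)) exchange_big /= (bigD1 0) //= [X in _ + X]big1 => [|v hv].
  rewrite addr0 -mulr_sumr (eq_bigr (fun _ => 1)) => [|w _].
    rewrite sumr_const card_mx mul1n /Lam; have -> : Apol (0 : 'rV[F]_n) = 1.
      by rewrite /Apol linear0 mulr0 addr0.
    by rewrite flog1; case: hpsi => -> _; rewrite mul1r.
  by rewrite coef_ApolM big1 ?mulr0 => [|i _]; [case: hpsi | rewrite mxE mul0r].
rewrite -mulr_sumr sum_addchar_eq0 ?mulr0 //.
  case: hpsi => h0 hD; split.
    by rewrite coef_ApolM big1 ?mulr0 // => i _; rewrite mxE mulr0.
  move=> w w'; rewrite -hD -mulrDr !coef_ApolM -big_split; congr psi; congr (_ * _).
  by apply: eq_bigr => i _; rewrite mxE mulrDr.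
have [i hi] := rV0Pn _ hv.
have [|c hc] := @psi_scale_neq1 (f`_d *+ d * v 0 i); first by rewrite mulf_neq0.
exists (c *: delta_mx 0 (rev_ord i)); rewrite coef_ApolM (bigD1 i) //= big1 => [|j hj].
  by rewrite !mxE !eqxx mulr1 addr0 mulrA.
by rewrite !mxE (inj_eq rev_ord_inj) (negPf hj) andbF !mulr0.
Qed.

Lemma csum_Aint k : csum k \in Aint.
Proof.
rewrite rpred_sum // => v _; have [p p_pr pF] := finPcharP F.
apply: (@Aint_unity_root p); first exact: prime_gt0.
apply/unity_rootP; rewrite /Lam -(addcharMn hpsi) (mulrn_pchar pF).
by case: hpsi.
Qed.

End LambdaChar.

(** * Frobenius orbits and the divisors of a monic polynomial *)

Section Counting.
Variables (F : finFieldType) (K : closedFieldType) (emb : {rmorphism F -> K}).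
Notation Q := #|F|.

Let Frob (i : {rmorphism F -> K}) (z : K) := z ^+ #|F|.

Fact Frob_is_zmod_morphism : zmod_morphism (Frob emb).
Proof. by move=> x y; rewrite /Frob exprB_pchar ?(card_pnat emb). Qed.
Fact Frob_is_monoid_morphism : monoid_morphism (Frob emb).
Proof. by split => [|x y]; rewrite /Frob ?expr1n ?exprMn. Qed.
HB.instance Definition _ := GRing.isZmodMorphism.Build K K (Frob emb) Frob_is_zmod_morphism.
HB.instance Definition _ := GRing.isMonoidMorphism.Build K K (Frob emb) Frob_is_monoid_morphism.

Lemma FrobX_inj n : injective (fun z : K => z ^+ (Q ^ n)).
Proof.
move=> x y /eqP; rewrite -subr_eq0 -exprB_pchar ?(cardX_pnat emb) // expf_eq0 subr_eq0.
by case/andP => _ /eqP.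
Qed.

Definition conj_poly (x : K) m : {poly K} := \prod_(0 <= i < m) ('X - (x ^+ (Q ^ i))%:P).

Lemma conj_poly_seq x m :
  conj_poly x m = \prod_(y <- [seq x ^+ (Q ^ i) | i <- iota 0 m]) ('X - y%:P).
Proof. by rewrite big_map /conj_poly /index_iota subn0. Qed.

Lemma conj_poly_monic x m : conj_poly x m \is monic.
Proof. exact: monic_prod_XsubC. Qed.

Lemma size_conj_poly x m : size (conj_poly x m) = m.+1.
Proof. by rewrite conj_poly_seq size_prod_XsubC size_map size_iota. Qed.

Lemma conj_poly_fixed x m : x ^+ (Q ^ m) = x ->
  map_poly (Frob emb) (conj_poly x m) = conj_poly x m.
Proof.
move=> hx; rewrite /conj_poly rmorph_prod /=.
under eq_bigr do rewrite rmorphB /= map_polyX map_polyC /= /Frob -exprM -expnSr.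
(* Frobenius moves each factor to the next one; multiplied by the first factor, both sides become
   the same product of [m + 1] factors. *)
apply: (@mulfI _ ('X - (x ^+ (Q ^ 0))%:P)); first by rewrite polyXsubC_eq0.
rewrite -(@big_nat_recl _ _ _ m 0 (fun i => 'X - (x ^+ (Q ^ i))%:P)) //.
by rewrite big_nat_recr //= hx expn0 expr1 mulrC.
Qed.

Definition iinv (z : K) : F := odflt 0 [pick c | emb c == z].

Lemma iinvK z : z ^+ Q = z -> emb (iinv z) = z.
Proof.
move=> /(emb_fixed emb)[c ->]; rewrite /iinv.
by case: pickP => [b /eqP //|/(_ c)]; rewrite eqxx.
Qed.

(** For [x] in the field of [Q^m] elements, the norm of [X - x] down to [F]: the power of degree [m]
    of the minimal polynomial of [x]. *)
Definition conj_norm (x : K) m : {poly F} := \poly_(i < m.+1) iinv (conj_poly x m)`_i.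

Lemma map_conj_norm x m : x ^+ (Q ^ m) = x -> map_poly emb (conj_norm x m) = conj_poly x m.
Proof.
move=> hx; apply/polyP => i; rewrite coef_map coef_poly /=.
case: ltnP => hi; last by rewrite rmorph0 nth_default // size_conj_poly.
by rewrite iinvK // -{2}(conj_poly_fixed hx) coef_map.
Qed.

Lemma conj_norm_monic x m : x ^+ (Q ^ m) = x -> conj_norm x m \is monic.
Proof.
move=> hx; rewrite monicE -(inj_eq (fmorph_inj emb)) rmorph1 -lead_coef_map.
by rewrite map_conj_norm //; have := conj_poly_monic x m; rewrite monicE.
Qed.

Lemma size_conj_norm x m : x ^+ (Q ^ m) = x -> size (conj_norm x m) = m.+1.
Proof. by move=> hx; rewrite -(size_map_poly emb) map_conj_norm // size_conj_poly. Qed.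

Section Orbit.
Variables (x : K) (e : nat).
Hypotheses (e0 : (0 < e)%N) (hx : x ^+ (Q ^ e) = x).
Hypothesis hmin : forall i, (0 < i)%N -> x ^+ (Q ^ i) = x -> (e <= i)%N.

Lemma orbit_periodic i t : x ^+ (Q ^ (e * t + i)) = x ^+ (Q ^ i).
Proof.
elim: t => [|t IH]; first by rewrite muln0.
by rewrite mulnS -addnA expnD exprM hx.
Qed.

Lemma orbit_dvd i : (x ^+ (Q ^ i) == x) = (e %| i)%N.
Proof.
apply/eqP/idP => [|/dvdnP[t ->]]; last first.
  by rewrite mulnC -[(e * t)%N]addn0 orbit_periodic expn0 expr1.
rewrite {1}(divn_eq i e) mulnC orbit_periodic => h; rewrite /dvdn.
case: posnP => // hpos; have := hmin hpos h.
by rewrite leqNgt ltn_mod e0.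
Qed.

Lemma orbit_uniq : uniq [seq x ^+ (Q ^ i) | i <- iota 0 e].
Proof.
rewrite map_inj_in_uniq ?iota_uniq // => i j; rewrite !mem_iota !add0n /=.
wlog hij : i j / (i <= j)%N => [H hi hj h|].
  by case/orP: (leq_total i j) => hl; [|apply: esym]; apply: H.
move=> hi hj; rewrite -(subnK hij) addnC expnD exprM exprAC -[LHS]/((fun z => z ^+ (Q ^ i)) x).
move/(FrobX_inj (n := i))/esym/eqP; rewrite orbit_dvd => /dvdnP[[|t] ht].
  by rewrite ht mul0n addn0.
by have : (e <= j - i)%N; [rewrite ht mulSn leq_addr | lia].
Qed.

Lemma conj_poly_mul t : conj_poly x (e * t) = conj_poly x e ^+ t.
Proof.
elim: t => [|t IH]; first by rewrite muln0 /conj_poly big_nil expr0.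
rewrite mulnS exprS -IH /conj_poly (@big_cat_nat _ _ _ e) ?leq_addr //=; congr (_ * _).
rewrite -{1}[e]add0n big_addn addKn; apply: eq_bigr => i _.
by rewrite addnC -[e]muln1 orbit_periodic.
Qed.

Lemma conj_norm_mul t : conj_norm x (e * t) = conj_norm x e ^+ t.
Proof.
apply: (map_poly_inj emb); rewrite rmorphXn /= !map_conj_norm //.
  exact: conj_poly_mul.
by apply/eqP; rewrite orbit_dvd dvdn_mulr.
Qed.

Lemma conj_norm_dvd (g : {poly F}) : root (map_poly emb g) x -> conj_norm x e %| g.
Proof.
move=> hg; rewrite -(dvdp_map emb) map_conj_norm // conj_poly_seq.
apply: uniq_roots_dvdp; last by rewrite uniq_rootsE orbit_uniq.
apply/allP => _ /mapP[i _ ->]; rewrite /root -horner_Frob expf_eq0.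
by move: hg; rewrite /root => ->; rewrite andbT expn_gt0 (ltnW (card_gt1 F)).
Qed.

(** When [e] is the period, [conj_norm x e] is the minimal polynomial of [x]: [x] is a simple root
    of it, and it can be split off from [g] as long as [x] remains a root. *)
Lemma conj_norm_exp_dvd (g : {poly F}) t : g != 0 ->
  (conj_norm x e ^+ t %| g) = (t <= mup x (map_poly emb g))%N.
Proof.
have N0 : conj_norm x e != 0 by rewrite monic_neq0 ?conj_norm_monic.
have mN : mup x (map_poly emb (conj_norm x e)) = 1%N.
  rewrite map_conj_norm // conj_poly_seq mu_prod_XsubC count_uniq_mem ?orbit_uniq //.
  apply/eqP; rewrite eqb1; apply/mapP; exists 0%N; rewrite ?mem_iota ?expn0 ?expr1 //.
move=> g0; apply/idP/idP => [/dvdpP[u hu]|].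
  have u0 : u != 0 by apply: contraNneq g0 => u0; rewrite hu u0 mul0r.
  rewrite hu rmorphM rmorphXn /= mupM ?map_poly_eq0 ?expf_neq0 ?map_poly_eq0 //.
  apply: leq_trans (leq_addl _ _).
  elim: t {hu} => // t IH; rewrite exprS mupM ?expf_neq0 ?map_poly_eq0 //.
  by rewrite mN add1n ltnS.
elim: t g g0 => [|t IH] g g0 ht; first by rewrite expr0 dvd1p.
have /conj_norm_dvd/dvdpP[u hu] : root (map_poly emb g) x.
  by rewrite -dvdp_XsubCl XsubC_dvd ?map_poly_eq0 // (leq_trans _ ht).
have u0 : u != 0 by apply: contraNneq g0 => u0; rewrite hu u0 mul0r.
rewrite hu exprSr dvdp_mul // IH //; move: ht.
by rewrite hu rmorphM mupM ?map_poly_eq0 // mN addn1 ltnS.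
Qed.

(** Only multiples [e t] of the period contribute, and [conj_norm x (e * t)] is the [t]-th power of
    the minimal polynomial; so exactly [t = 1, ..., mu] are counted. *)
Lemma count_orbit (g : {poly F}) k : g != 0 -> size g = k.+1 ->
  (\sum_(r < k) ((x ^+ (Q ^ r.+1) == x) && (conj_norm x r.+1 %| g)%R) =
   mup x (map_poly emb g))%N.
Proof.
move=> g0 sg; set mu := mup _ _.
have he t : (t <= mu)%N = (conj_norm x (e * t) %| g) by rewrite conj_norm_mul conj_norm_exp_dvd.
have emu : (e * mu <= k)%N.
  have := leqnn mu; rewrite he => /dvdp_leq-/(_ g0).
  rewrite size_conj_norm ?sg //; apply/eqP; rewrite orbit_dvd dvdn_mulr //.
rewrite -(big_mkord xpredT (fun r => nat_of_bool ((x ^+ (Q ^ r.+1) == x) && (conj_norm x r.+1 %| g)%R))).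
rewrite -big_mkcond /= sum1_count -size_filter -[RHS](size_iota 0) -[RHS](size_map (fun t => (e * t.+1).-1)).
apply: perm_size; apply: uniq_perm.
- by rewrite filter_uniq // iota_uniq.
- rewrite map_inj_uniq ?iota_uniq // => i j /(congr1 succn).
  by rewrite !prednK ?muln_gt0 ?e0 // => /eqP; rewrite eqn_pmul2l // => /eqP[].
move=> r; rewrite mem_filter mem_index_iota /=; apply/idP/mapP.
  case/andP => /andP[]; rewrite orbit_dvd => /dvdnP[[|t] ht] hd hr //.
  exists t; last by rewrite mulnC -ht.
  by rewrite mem_iota /= add0n he mulnC -ht.
case=> t; rewrite mem_iota /= add0n he => ht ->.
rewrite prednK ?muln_gt0 ?e0 // orbit_dvd dvdn_mulr // ht /=.
apply: leq_trans emu.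
by rewrite leq_mul2l he ht orbT.
Qed.

End Orbit.

(** The orbit stays among the finitely many roots of [g], so two of its terms coincide; injectivity
    of Frobenius then makes it purely periodic. *)
Lemma root_orbit (g : {poly F}) x : g != 0 -> root (map_poly emb g) x ->
  exists e, [/\ (0 < e)%N, x ^+ (Q ^ e) = x &
    forall i, (0 < i)%N -> x ^+ (Q ^ i) = x -> (e <= i)%N].
Proof.
move=> g0 hg; have hroot i : root (map_poly emb g) (x ^+ (Q ^ i)).
  rewrite /root -horner_Frob expf_eq0; move: hg; rewrite /root => ->.
  by rewrite andbT expn_gt0 (ltnW (card_gt1 F)).
have [i [j [hij e]]] : exists i j, (i < j)%N /\ x ^+ (Q ^ i) = x ^+ (Q ^ j).
  have : ~~ uniq [seq x ^+ (Q ^ i) | i <- iota 0 (size g)].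
    apply/negP => hu; have := @max_poly_roots _ (map_poly emb g) [seq x ^+ (Q ^ i) | i <- iota 0 (size g)].
    rewrite map_poly_eq0 size_map_poly size_map size_iota ltnn => H.
    by suff : false by []; apply: H => //; apply/allP => _ /mapP[i _ ->].
  case/(uniqPn 0) => i [j [hij]]; rewrite size_map size_iota => hj.
  rewrite !(nth_map 0%N) ?size_iota ?(ltn_trans hij) // !nth_iota ?(ltn_trans hij) // => h.
  by exists i, j.
have ex : exists e, (0 < e)%N && (x ^+ (Q ^ e) == x).
  exists (j - i)%N; rewrite subn_gt0 hij; apply/eqP.
  apply: (FrobX_inj (n := i)); rewrite /= e -exprM -expnD subnK //; exact: ltnW.
exists (ex_minn ex); case: ex_minnP => m /andP[m0 /eqP hm] hmin; split => // k k0 hk.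
by apply: hmin; rewrite k0 hk eqxx.
Qed.

(* Unique factorization of [g], with each power of an irreducible factor counted
   once for each of its roots; it plays the part of the Euler product. *)
Lemma count_conj_norm (g : {poly F}) k : g \is monic -> size g = k.+1 ->
  (\sum_(r < k) \sum_(x <- Fix F K r.+1) (conj_norm x r.+1 %| g)%R = k)%N.
Proof.
move=> gm sg; have g0 : g != 0 by rewrite monic_neq0.
have [xs hxs] := closed_field_poly_normal (map_poly emb g).
rewrite lead_coef_map (eqP gm) rmorph1 scale1r in hxs.
have sxs : size xs = k.
  by have := size_map_poly emb g; rewrite hxs size_prod_XsubC sg => -[].
transitivity (\sum_(x <- undup xs) count_mem x xs)%N; last first.
  rewrite -sxs -sum1_size -(big_undup_iterop_count _ xs xpredT (fun _ => 1%N)) /=.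
  by apply: eq_bigr => y _; rewrite Monoid.iteropE iter_addn_0 mul1n.
transitivity (\sum_(r < k) \sum_(x <- undup xs) ((x ^+ (Q ^ r.+1) == x) && (conj_norm x r.+1 %| g)%R))%N.
  apply: eq_bigr => r _; rewrite -!big_mkcond /= !sum1_count -!size_filter.
  apply: perm_size; apply: uniq_perm.
  - by rewrite filter_uniq // (uniq_Fix emb).
  - by rewrite filter_uniq // undup_uniq.
  move=> y; rewrite !mem_filter mem_undup mem_Fix //.
  have [hy|] := boolP (y ^+ _ == y); rewrite ?andbF //= andbT.
  have [hd|] //= := boolP (_ %| g); rewrite -root_prod_XsubC -hxs.
  move: hd; rewrite -(dvdp_map emb) map_conj_norm ?(eqP hy) // => /dvdpP[u ->].
  rewrite rootM; apply/esym/orP; right; rewrite conj_poly_seq root_prod_XsubC.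
  by apply/mapP; exists 0%N; rewrite ?mem_iota ?expn0 ?expr1.
rewrite exchange_big /= big_seq [RHS]big_seq; apply: eq_bigr => y.
rewrite mem_undup -root_prod_XsubC -hxs => hy.
have [e [e0 he hmin]] := root_orbit g0 hy.
by rewrite (count_orbit e0 he hmin g0 sg) hxs mu_prod_XsubC.
Qed.

End Counting.

(** * The L-function and its reciprocal roots *)

Section LFunction.
Variables (F : finFieldType) (K : closedFieldType) (emb : {rmorphism F -> K}).
Variables (psi : F -> algC) (f : {poly F}) (n : nat).
Hypothesis hpsi : addchar psi.
Hypothesis psi_neq1 : exists c, psi c != 1.
Hypothesis f0 : f`_0 = 0.
Hypothesis size_f : size f = n.+2.
Hypothesis fd0 : f`_n.+1 *+ n.+1 != 0.
Notation Q := #|F|.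
Notation Lam := (Lam psi f n).
Notation csum := (csum psi f n).

(** The monic polynomial of degree [k] whose reverse is [Apol v]; [vof] goes back. *)
Definition hpol k (v : 'rV[F]_k) : {poly F} := \poly_(i < k.+1) (Apol v)`_(k - i).

Definition vof k (h : {poly F}) : 'rV[F]_k := \row_(i < k) h`_(k - i.+1).

Lemma size_hpol k (v : 'rV[F]_k) : size (hpol v) = k.+1.
Proof. by rewrite size_poly_eq // subnn Apol0 oner_eq0. Qed.

Lemma hpol_monic k (v : 'rV[F]_k) : hpol v \is monic.
Proof. by rewrite monicE lead_coefE size_hpol coef_poly ltnSn subnn Apol0. Qed.

Lemma hpolK k (h : {poly F}) : h \is monic -> size h = k.+1 -> hpol (vof k h) = h.
Proof.
move=> hm sh; apply/polyP => i; rewrite coef_poly; case: ltnP => hi; last first.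
  by rewrite nth_default // sh.
case E : (k - i)%N => [|j].
  have -> : i = k by lia.
  by rewrite Apol0; move: hm; rewrite monicE lead_coefE sh => /eqP.
have hj : (j < k)%N by lia.
rewrite -[j]/(val (Ordinal hj)) ApolS mxE; congr (_`_ _); rewrite /=; lia.
Qed.

Lemma vofK k (v : 'rV[F]_k) : vof k (hpol v) = v.
Proof.
apply/rowP => i; rewrite mxE coef_poly ifT; last by have := ltn_ord i; lia.
by rewrite subKn ?ApolS.
Qed.

Lemma flog_roots k (v : 'rV[F]_k) xs :
  map_poly emb (hpol v) = \prod_(x <- xs) ('X - x%:P) ->
  emb (flog f n (Apol v)) = \sum_(x <- xs) (map_poly emb f).[x].
Proof.
move=> hxs; have sxs : size xs = k.
  by have := size_map_poly emb (hpol v); rewrite hxs size_prod_XsubC size_hpol => -[].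
have hA : map_poly emb (Apol v) = rev_roots xs.
  apply/polyP => i; rewrite coef_map /=; case: (leqP i k) => hi.
    rewrite coef_rev_roots ?sxs // -hxs coef_map /= coef_poly ltnS leq_subr.
    by rewrite subKn.
  rewrite Apol_big // rmorph0 nth_default //.
  by apply: leq_trans (size_rev_roots _) _; rewrite sxs.
rewrite rmorph_sum /=.
have -> : \sum_(x <- xs) (map_poly emb f).[x] = \sum_(j < n.+2) emb f`_j * \sum_(x <- xs) x ^+ j.
  under eq_bigr => x _ do rewrite horner_coef size_map_poly size_f.
  rewrite exchange_big /=; apply: eq_bigr => j _; rewrite mulr_sumr.
  by apply: eq_bigr => x _; rewrite coef_map.
apply: eq_bigr => -[[|j] hj] _ /=; first by rewrite f0 mul0r rmorph0 mul0r.
by rewrite rmorphM map_psum ?Apol0 // hA psum_rev_roots.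
Qed.

(** The multiples of [N = conj_norm emb x m] are the [N h] with [h] monic of degree [k - m]. The
    roots of [N] are the conjugates of [x], so [N] contributes the trace of [f(x)]. *)
Lemma csum_conj k m (x : K) : (0 < m <= k)%N -> x \in Fix F K m ->
  \sum_(v : 'rV[F]_k | conj_norm emb x m %| hpol v) Lam (Apol v) =
  psi (Ftrace emb m (map_poly emb f).[x]) * csum (k - m).
Proof.
case/andP => m0 hmk /(FixP m0) hx; set N := conj_norm emb x m.
have Nm : N \is monic by apply: conj_norm_monic.
have sN : size N = m.+1 by apply: size_conj_norm.
have N0 : N != 0 by rewrite monic_neq0.
have hprod (w : 'rV[F]_(k - m)) : hpol (vof k (N * hpol w)) = N * hpol w.
  apply: hpolK; first by rewrite monicMl ?hpol_monic.
  by rewrite size_monicM ?monic_neq0 ?hpol_monic // sN size_hpol addSn addnS subnKC.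
rewrite (reindex_onto (fun w : 'rV[F]_(k - m) => vof k (N * hpol w))
                      (fun v => vof (k - m) (hpol v %/ N))) /=; last first.
  move=> v /dvdpP[u hu]; rewrite hu mulpK //.
  have um : u \is monic.
    by have := hpol_monic v; rewrite hu monicMr.
  have su : size u = (k - m).+1.
    have := size_hpol v; rewrite hu size_monicM ?monic_neq0 // sN.
    by rewrite addnS /= => h; apply/eqP; rewrite -(eqn_add2r m) h addSn subnK.
  by rewrite (hpolK um su) mulrC -hu vofK.
rewrite /csum mulr_sumr; apply: eq_big => w.
  by rewrite hprod dvdp_mulr ?dvdpp // mulrC mulpK // vofK eqxx.
move=> _; rewrite /Lam -(proj2 hpsi); congr psi; apply: (fmorph_inj emb).
have [ws hws] := closed_field_poly_normal (map_poly emb (hpol w)).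
rewrite lead_coef_map (eqP (hpol_monic w)) rmorph1 scale1r in hws.
rewrite rmorphD (flog_roots hws) emb_Ftrace; last by rewrite horner_Frob hx.
rewrite (@flog_roots _ _ ([seq x ^+ (Q ^ i) | i <- iota 0 m] ++ ws)).
  rewrite big_cat big_map /Ktrace; congr (_ + _).
  rewrite -(big_mkord xpredT (fun i => (map_poly emb f).[x] ^+ (Q ^ i))) /index_iota subn0.
  by apply: eq_bigr => i _; rewrite horner_Frob.
by rewrite hprod rmorphM /= map_conj_norm // conj_poly_seq hws big_cat.
Qed.

(** The degree [k] of each monic polynomial is replaced by the number of pairs [(r, x)] in
    [count_conj_norm], and the sums are exchanged. This is the logarithmic derivative of the
    L-function, coefficientwise. *)
Lemma csum_rec k :
  csum k * k%:R = \sum_(r < k) expsum emb psi f r.+1 * csum (k - r.+1).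
Proof.
have hk (v : 'rV[F]_k) : k%:R = \sum_(r < k) \sum_(x <- Fix F K r.+1)
    (conj_norm emb x r.+1 %| hpol v)%R%:R :> algC.
  rewrite -[in LHS](count_conj_norm emb (hpol_monic v) (size_hpol v)) natr_sum.
  by apply: eq_bigr => r _; rewrite natr_sum.
rewrite /csum mulr_suml.
under eq_bigr => v _ do rewrite (hk v) mulr_sumr.
rewrite exchange_big /=; apply: eq_bigr => r _.
under eq_bigr => v _ do rewrite mulr_sumr.
rewrite exchange_big /= /expsum mulr_suml big_seq [RHS]big_seq; apply: eq_bigr => x hx.
rewrite -csum_conj ?hx ?ltn_ord // [RHS]big_mkcond; apply: eq_bigr => v _.
by case: ifP; rewrite ?mulr1 ?mulr0.
Qed.

Definition Lpol : {poly algC} := \poly_(k < n.+1) csum k.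

Lemma coef_Lpol k : Lpol`_k = csum k.
Proof. by rewrite coef_poly; case: ltnP => // hk; rewrite csum_eq0. Qed.

Lemma newton_Lpol : newton Lpol (fun r => - expsum emb psi f r).
Proof.
move=> k; rewrite coef_Lpol -mulr_natr csum_rec (reindex_inj rev_ord_inj) /=.
rewrite -big_split big1 // => i _ /=; rewrite coef_Lpol.
have hi := ltn_ord i.
have -> : (k.+1 - (k.+1 - i.+1).+1 = i)%N by lia.
have -> : ((k.+1 - i.+1).+1 = k.+1 - i)%N by lia.
by rewrite mulrN mulrC subrr.
Qed.

Lemma Lroots : exists ws : seq algC, [/\ size ws = n, Lpol = rev_roots ws,
  rev_roots ws \is a polyOver Aint &
  forall r, (0 < r)%N -> expsum emb psi f r = - \sum_(w <- ws) w ^+ r].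
Proof.
pose P : {poly algC} := \poly_(i < n.+1) csum (n - i).
have sP : size P = n.+1 by rewrite size_poly_eq // subnn csum0 // oner_eq0.
have Pm : P \is monic by rewrite monicE lead_coefE sP coef_poly ltnSn subnn csum0.
have [ws hws] := closed_field_poly_normal P.
rewrite (eqP Pm) scale1r in hws.
have sws : size ws = n by move: sP; rewrite hws size_prod_XsubC => -[].
have eL : Lpol = rev_roots ws.
  apply/polyP => i; rewrite coef_Lpol; case: (leqP i n) => hi.
    by rewrite coef_rev_roots ?sws // -hws coef_poly ltnS leq_subr subKn.
  rewrite csum_eq0 // nth_default //.
  by apply: leq_trans (size_rev_roots _) _; rewrite sws.
exists ws; split => //.
  by rewrite -eL; apply/polyOverP => i; rewrite coef_Lpol csum_Aint.
move=> r r0; apply: oppr_inj; rewrite opprK.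
apply: (newton_uniq (A := Lpol) (s := fun r => - expsum emb psi f r)
  (t := fun r => \sum_(w <- ws) w ^+ r)) => //.
- by rewrite coef_Lpol csum0.
- exact: newton_Lpol.
by rewrite eL; apply: newton_rev_roots.
Qed.

End LFunction.

(** * The Riemann hypothesis *)

(** By Newton's identities [(k+1) |A_(k+1)|] is at most a sum of [k+1] terms [(C X)^i C X^(k+1-i)],
    each at most [(C X)^(k+1)] because [C >= 1]. *)
Lemma rev_roots_coef_bound (ws : seq algC) (C X : algC) k : 1 <= C -> 0 <= X ->
  (forall j, (0 < j)%N -> `|\sum_(w <- ws) w ^+ j| <= C * X ^+ j) ->
  `|(rev_roots ws)`_k| <= (C * X) ^+ k.
Proof.
move=> C1 X0 hp; have C0 : 0 <= C by apply: le_trans C1.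
elim/ltn_ind: k => -[_|k IH].
  rewrite -horner_coef0 /rev_roots horner_prod big1 ?normr1 ?expr0 // => x _.
  by rewrite !hornerE subr0.
have h := newton_rev_roots ws k.
rewrite -(ler_pM2r (ltr0Sn _ k)) -{1}(normr_nat _ k.+1) -normrM mulr_natr.
move/eqP: h; rewrite addr_eq0 => /eqP ->; rewrite normrN.
apply: (le_trans (ler_norm_sum _ _ _)).
rewrite mulr_natr -[X in _ *+ X](card_ord k.+1) -sumr_const; apply: ler_sum => i _.
have hi := ltn_ord i; rewrite normrM.
apply: (le_trans (ler_pM (normr_ge0 _) (normr_ge0 _) (IH _ hi) (hp _ _))); first by rewrite subn_gt0.
rewrite !exprMn mulrACA -exprD subnKC ?(ltnW hi) // ler_wpM2r ?exprn_ge0 //.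
by rewrite -exprSr ler_weXn2l.
Qed.

Lemma geometric_tail (t Y : algC) m : 0 <= Y -> 2%:R * Y < t ->
  \sum_(j < m) Y ^+ (m - j) * t ^+ j < t ^+ m.
Proof.
move=> Y0 ht; have t0 : 0 < t by apply: le_lt_trans ht; rewrite mulr_ge0 ?ler0n.
elim: m => [|m IH]; first by rewrite big_ord0 expr0 ltr01.
rewrite big_ord_recr /= subSnn expr1.
have -> : \sum_(i < m) Y ^+ (m.+1 - i) * t ^+ i = Y * \sum_(i < m) Y ^+ (m - i) * t ^+ i.
  by rewrite mulr_sumr; apply: eq_bigr => i _; rewrite subSn ?(ltnW (ltn_ord i)) // exprS mulrA.
rewrite -mulrDr; apply: (@le_lt_trans _ _ (Y * (t ^+ m + t ^+ m))).
  by rewrite ler_wpM2l // lerD2r ltW.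
by rewrite -mulr2n -mulr_natl mulrA [Y * _]mulrC exprS ltr_pM2r // exprn_gt0.
Qed.

(** A Cauchy-type bound on the roots. The factor [2 C] is harmless, since the lemma is applied to
    ever higher powers of the roots with [C] fixed. *)
Lemma power_sums_root_bound (ws : seq algC) (C X w : algC) : 1 <= C -> 0 <= X ->
  (forall j, (0 < j)%N -> `|\sum_(w <- ws) w ^+ j| <= C * X ^+ j) ->
  w \in ws -> `|w| <= 2%:R * (C * X).
Proof.
move=> C1 X0 hp hw; have C0 : 0 <= C := le_trans ler01 C1.
have Y0 : 0 <= C * X by rewrite mulr_ge0.
rewrite real_leNgt ?ger0_real ?normr_ge0 ?mulr_ge0 ?ler0n //; apply/negP => ht.
have := geometric_tail (size ws) Y0 ht; apply/negP.
suff h : `|w| ^+ size ws <= \sum_(j < size ws) (C * X) ^+ (size ws - j) * `|w| ^+ j by rewrite le_gtF.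
set P := \prod_(x <- ws) ('X - x%:P).
have hP : P.[w] = 0 by apply/rootP; rewrite root_prod_XsubC.
have lP : P`_(size ws) = 1.
  by have := monic_prod_XsubC ws xpredT id; rewrite monicE lead_coefE size_prod_XsubC => /eqP.
have : w ^+ size ws = - \sum_(j < size ws) P`_j * w ^+ j.
  move: hP; rewrite horner_coef size_prod_XsubC big_ord_recr /= lP mul1r => h.
  by apply/eqP; rewrite -addr_eq0 addrC h.
move=> e; rewrite -normrX e normrN; apply: (le_trans (ler_norm_sum _ _ _)).
apply: ler_sum => j _; rewrite normrM normrX ler_wpM2r ?exprn_ge0 ?normr_ge0 //.
have hj := ltn_ord j; have := rev_roots_coef_bound (size ws - j) C1 X0 hp.
by rewrite coef_rev_roots ?leq_subr // subKn // ltnW.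
Qed.

Lemma bernoulli (y : algC) a : 0 <= y -> 1 + y *+ a <= (1 + y) ^+ a.
Proof.
move=> y0; elim: a => [|a IH]; first by rewrite mulr0n addr0 expr0.
rewrite exprS mulrDl mul1r mulrSr addrA lerD // ler_peMr //.
by rewrite exprn_ege1 // lerDl.
Qed.

Lemma bounded_powers (x C : algC) a0 : 0 <= x ->
  (forall a, (a0 <= a)%N -> x ^+ a <= C) -> x <= 1.
Proof.
move=> x0 hx; rewrite real_leNgt ?ger0_real ?ler01 //; apply/negP => h1.
set y := x - 1; have y0 : 0 < y by rewrite subr_gt0.
have ex : x = 1 + y by rewrite /y addrC subrK.
have C0 : 0 <= C / y by rewrite divr_ge0 ?(ltW y0) // (le_trans _ (hx a0 _)) ?exprn_ge0.
have hb := archi_boundP C0; set b := Num.bound _ in hb.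
have := hx (maxn a0 b) (leq_maxl _ _); apply/negP.
suff h : C < x ^+ maxn a0 b by rewrite lt_geF.
rewrite ex; apply: lt_le_trans (bernoulli _ (ltW y0)).
rewrite ltr_wpDl // -mulr_natl -ltr_pdivrMr // (lt_le_trans hb) // ler_nat leq_maxr //.
Qed.

Lemma prod_eq_max (xs : seq algC) (q : algC) : 0 < q ->
  (forall x, x \in xs -> 0 <= x <= q) -> \prod_(x <- xs) x = q ^+ size xs ->
  forall x, x \in xs -> x = q.
Proof.
move=> q0; elim: xs => // y xs IH h; rewrite big_cons /= exprS => e.
have hxs x : x \in xs -> 0 <= x <= q by move=> hx; apply: h; rewrite inE hx orbT.
have /andP[y0 yq] : 0 <= y <= q by apply: h; rewrite inE eqxx.
have [p0 pq] : 0 <= \prod_(x <- xs) x /\ \prod_(x <- xs) x <= q ^+ size xs.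
  elim: xs {IH h e} hxs => [|z xs IH] hxs; first by rewrite big_nil ler01.
  have /andP[z0 zq] := hxs z (mem_head _ _).
  have [|h1 h2] := IH; first by move=> x hx; apply: hxs; rewrite inE hx orbT.
  by rewrite big_cons /= exprS; split; [rewrite mulr_ge0|rewrite ler_pM].
have ey : y = q.
  apply/eqP; rewrite eq_le yq /= real_leNgt ?ger0_real ?(ltW q0) //; apply/negP => hy.
  have : y * \prod_(x <- xs) x < q * q ^+ size xs.
    by apply: (@le_lt_trans _ _ (y * q ^+ size xs)); [rewrite ler_wpM2l|rewrite ltr_pM2r ?exprn_gt0].
  by rewrite e ltxx.
move=> x; rewrite inE => /predU1P[->//|]; apply: IH => //.
by apply: (mulfI (lt0r_neq0 q0)); rewrite -e ey.
Qed.

(** * Weil's theorem in degree prime to the characteristic *)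

Section Weil.
Variables (F : finFieldType) (K : closedFieldType) (emb : {rmorphism F -> K}).
Variables (psi : F -> algC).
Hypothesis hpsi : addchar psi.
Hypothesis psi_neq1 : exists c, psi c != 1.
Notation Q := #|F|.

Lemma coprime_natr_neq0 d : d%:R != 0 :> F -> coprime d Q.
Proof.
have [p p_pr pF] := finPcharP F.
rewrite natf_neq0_pchar coprime_sym => hd.
have hQ : [pchar F].-nat Q by rewrite -(eq_pnat _ (fmorph_pchar emb)) card_pnat.
exact: pnat_coprime hQ hd.
Qed.

Lemma weil_no_constant (f : {poly F}) n : f`_0 = 0 -> size f = n.+2 -> n.+1%:R != 0 :> F ->
  exists ws : seq algC, [/\ size ws = n, rev_roots ws \is a polyOver Aint,
  (forall w, w \in ws -> `|w| ^+ 2 = Q%:R) &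
  forall r, (0 < r)%N -> expsum emb psi f r = - \sum_(w <- ws) w ^+ r].
Proof.
move=> f0 size_f hn.
have fd0 : f`_n.+1 *+ n.+1 != 0.
  rewrite -mulr_natr mulf_neq0 // -[n.+1]/(n.+2.-1) -size_f -lead_coefE lead_coef_eq0.
  by rewrite -size_poly_eq0 size_f.
have [ws [sws eL hA hS]] := Lroots emb hpsi psi_neq1 f0 size_f fd0.
exists ws; split => //.
set D := (Q * n.+1)%N; pose C : algC := (2 * D + 1)%:R.
have Q0 : 0 < Q%:R :> algC by rewrite ltr0n (ltnW (card_gt1 F)).
have upper w : w \in ws -> `|w| ^+ 2 <= Q%:R.
  move=> hw; rewrite -[leRHS]mul1r -ler_pdivrMr //.
  (* The [2a]-th powers of the roots have power sums bounded by [C (Q^a)^j], so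
     [(|w|^2 / Q)^a <= 2 C] for all large [a]. The threshold on [a] gives the size condition of
     [expsum_bound], because [a < Q^a]. *)
  apply: (@bounded_powers _ (2%:R * C) (D ^ 2 + 3 * D + 1).+1).
    by rewrite divr_ge0 ?exprn_ge0 ?normr_ge0 ?ltW.
  move=> a ha; have hs b : (a <= b)%N -> (D ^ 2 + 3 * D + 1 < Q ^ b)%N.
    by move=> hb; apply: (leq_trans (leq_trans ha hb)); rewrite ltnW // ltn_expl // card_gt1.
  rewrite expr_div_n ler_pdivrMr ?exprn_gt0 // -exprM -normrX -mulrA.
  apply: (@power_sums_root_bound [seq w ^+ (2 * a) | w <- ws]).
  - by rewrite ler1n addn1.
  - by rewrite exprn_ge0 ?ltW.
  - move=> j j0; rewrite big_map; under eq_bigr do rewrite -exprM.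
    have a0 : (0 < a)%N by apply: leq_ltn_trans ha.
    rewrite -[\sum_(w0 <- ws) _]opprK normrN -hS ?muln_gt0 ?a0 //.
    rewrite -mulnA -exprM -natrX -natrM.
    apply: (expsum_bound emb hpsi psi_neq1 size_f) => //; first exact: coprime_natr_neq0.
    by apply: hs; rewrite leq_pmulr.
  by apply: (map_f (fun w => w ^+ (2 * a))).
(* The product of the [|w|^2] is [|csum n|^2 = Q^n] and no factor exceeds [Q], so each equals
   [Q]. *)
move=> w hw; apply: (@prod_eq_max [seq `|w| ^+ 2 | w <- ws] _ Q0).
- by move=> _ /mapP[x hx ->]; rewrite exprn_ge0 ?normr_ge0 // upper.
- rewrite size_map sws big_map prodrXl -normr_prod.
  rewrite -natrX -(csum_norm hpsi psi_neq1 fd0) -(coef_Lpol hpsi psi_neq1 fd0) eL.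
  rewrite -sws coef_rev_roots // subnn coef0_prod_XsubC normrM normrX normrN1 expr1n mul1r.
  by [].
by apply: (map_f (fun w => `|w| ^+ 2)).
Qed.

Lemma Ftrace_const r c x : x \in Fix F K r -> (0 < r)%N ->
  Ftrace emb r (x + emb c) = Ftrace emb r x + c *+ r.
Proof.
move=> /FixP hx r0; apply: (fmorph_inj emb).
rewrite rmorphD !emb_Ftrace ?hx //; last by rewrite exprDn_pchar ?(cardX_pnat emb) // hx // emb_Frob.
rewrite (KtraceD emb) rmorphMn; congr (_ + _); rewrite /Ktrace.
by under eq_bigr do rewrite emb_Frob; rewrite sumr_const card_ord.
Qed.

(** A constant term [c] multiplies the sum over the extension of degree [r] by [psi(c)^r], that is,
    each root by the root of unity [psi(c)]. *)
Theorem weil (f : {poly F}) n : size f = n.+2 -> n.+1%:R != 0 :> F ->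
  exists ws : seq algC, [/\ size ws = n, rev_roots ws \is a polyOver Aint,
  (forall w, w \in ws -> `|w| ^+ 2 = Q%:R) &
  forall r, (0 < r)%N -> expsum emb psi f r = - \sum_(w <- ws) w ^+ r].
Proof.
move=> size_f hn; set c := f`_0; pose g := f - c%:P.
have g0 : g`_0 = 0 by rewrite coefB coefC subrr.
have sg : size g = n.+2.
  by rewrite size_polyDl ?size_f // size_polyN (leq_ltn_trans (size_polyC_leq1 _)).
have [ws [sws hA hN hS]] := weil_no_constant g0 sg hn.
exists [seq psi c * w | w <- ws]; split.
- by rewrite size_map.
- apply/polyOverP => i.
  have -> : rev_roots [seq psi c * w | w <- ws] = rev_roots ws \Po (psi c *: 'X).
    rewrite /rev_roots big_map rmorph_prod /=; apply: eq_bigr => w _.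
    by rewrite rmorphB rmorph1 /= comp_polyZ comp_polyX scalerA mulrC.
  have -> : (rev_roots ws \Po (psi c *: 'X))`_i = psi c ^+ i * (rev_roots ws)`_i.
    rewrite coef_comp_poly; case: (ltnP i (size (rev_roots ws))) => hi; last first.
      rewrite [X in _ = _ * X]nth_default // mulr0 big1 // => j _.
      rewrite exprZn coefZ coefXn; case: eqP => [ej|_]; last by rewrite !mulr0.
      by have := ltn_ord j; rewrite -ej ltnNge hi.
    rewrite (bigD1 (Ordinal hi)) //= big1 => [|j hj].
      by rewrite exprZn coefZ coefXn eqxx mulr1 addr0 mulrC.
    have /negPf hji : (i != j)%N by rewrite eq_sym; exact: hj.
    by rewrite exprZn coefZ coefXn hji !mulr0.
  apply: rpredM; last by apply: (polyOverP hA).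
  rewrite rpredX //; have [p p_pr pF] := finPcharP F.
  apply: (@Aint_unity_root p); first exact: prime_gt0.
  apply/unity_rootP; rewrite -(addcharMn hpsi) (mulrn_pchar pF); by case: hpsi.
- by move=> _ /mapP[w hw ->]; rewrite normrM (addchar_norm hpsi) mul1r hN.
move=> r r0; rewrite big_map; under eq_bigr do rewrite exprMn.
rewrite -mulr_sumr -mulrN -hS // /expsum mulr_sumr big_seq [RHS]big_seq; apply: eq_bigr => x hx.
rewrite -(addcharMn hpsi) -(proj2 hpsi) addrC; congr psi.
rewrite -Ftrace_const //; last exact: horner_Fix.
by rewrite /g rmorphB /= map_polyC !hornerE subrK.
Qed.

End Weil.

(** * Serre's refinement *)

Lemma Crat_rev_roots (ws : seq algC) k :
  (forall r, (0 < r)%N -> \sum_(w <- ws) w ^+ r \in Crat) -> (rev_roots ws)`_k \in Crat.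
Proof.
move=> hr; elim/ltn_ind: k => -[_|k IH].
  rewrite -horner_coef0 /rev_roots horner_prod big1 ?rpred1 // => x _.
  by rewrite !hornerE subr0.
have h := newton_rev_roots ws k; move/eqP: h; rewrite addr_eq0 -mulr_natr => /eqP h.
have -> : (rev_roots ws)`_k.+1 = (rev_roots ws)`_k.+1 * k.+1%:R / k.+1%:R.
  by rewrite mulfK // pnatr_eq0.
rewrite h rpred_div ?rpred_nat // rpredN rpred_sum // => i _.
by rewrite rpredM ?IH ?hr // subn_gt0.
Qed.

Lemma ge1_prod_sum (xs : seq algC) : (forall x, x \in xs -> 0 < x) ->
  1 <= \prod_(x <- xs) x -> (size xs)%:R <= \sum_(x <- xs) x.
Proof.
move=> xs0; rewrite (big_nth 0) big_mkord [X in _ -> _ <= X](big_nth 0) big_mkord.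
have [->|n0] := posnP (size xs); first by rewrite !big_ord0.
have nth0 (i : 'I_(size xs)) : 0 < xs`_i by apply/xs0/mem_nth.
have := leif_AGM (A := predT) (fun (i : 'I_(size xs)) _ => ltW (nth0 i)).
rewrite card_ord => -[hle _] h1.
have s0 : 0 <= \sum_(i < size xs) xs`_i by rewrite sumr_ge0 // => i _; apply: ltW.
have := le_trans h1 hle; rewrite -{1}(expr1n _ (size xs)) ler_pXn2r ?nnegrE ?ler01 ?divr_ge0 ?ler0n //.
by rewrite ler_pdivlMr ?ltr0n // mul1r.
Qed.

Lemma serre (ws : seq algC) Q : (0 < Q)%N ->
  (forall w, w \in ws -> `|w| ^+ 2 = Q%:R) -> rev_roots ws \is a polyOver Aint ->
  (forall r, (0 < r)%N -> \sum_(w <- ws) w ^+ r \in Crat) ->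
  \sum_(w <- ws) (w + w^*) <= (Num.floor (2%:R * sqrtC Q%:R : algC))%:~R * (size ws)%:R.
Proof.
move=> Q0 hN hA hr; set m := Num.floor _.
have Qn0 : Q%:R != 0 :> algC by rewrite pnatr_eq0 -lt0n.
(* With [w^*] written as [Q / w], the power sums of the [th w] expand into sums of integer powers of
   [w]. *)
have conjE w : w \in ws -> w^* = Q%:R / w.
  move=> hw; have w0 : w != 0.
    by apply: contraNneq Qn0 => e; rewrite -(hN w hw) e normr0 expr0n.
  by rewrite -(hN w hw) normCK mulrAC mulfV ?mul1r.
have unitw w : w \in ws -> w != 0.
  by move=> hw; apply: contraNneq Qn0 => e; rewrite -(hN w hw) e normr0 expr0n.
have coefZ i : (rev_roots ws)`_i \is a Num.int.
  by apply: Cint_rat_Aint; [apply: Crat_rev_roots | apply: (polyOverP hA)].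
have wA w : w \in ws -> w \in Aint.
  move=> hw; apply: (@root_monic_Aint (\prod_(x <- ws) ('X - x%:P))).
  - by rewrite root_prod_XsubC.
  - exact: monic_prod_XsubC.
  apply/polyOverP => i; case: (leqP i (size ws)) => hi.
    by have := coef_rev_roots (leq_subr i (size ws)); rewrite subKn // => <-.
  by rewrite nth_default ?rpred0 // size_prod_XsubC.
pose B : algC := (m + 1)%:~R.
pose th (w : algC) := B - w - w^*.
have ratW (a : int) : \sum_(w <- ws) w ^ a \in Crat.
  case: a => [[|r]|r]; first by rewrite big_const_seq iter_addr_0 rpredMn ?rpred1.
    exact: hr.
  have -> : \sum_(w <- ws) w ^ Negz r = (\sum_(w <- ws) w ^+ r.+1)^* / Q%:R ^+ r.+1.
    rewrite rmorph_sum mulr_suml big_seq [RHS]big_seq; apply: eq_bigr => w hw.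
    rewrite rmorphXn /= conjE // expr_div_n mulrAC mulfV ?expf_neq0 // mul1r.
    by rewrite NegzE -exprnN.
  by rewrite rpred_div ?rpredX ?rpred_nat // conj_Crat ?hr.
(* One factor [th w = B - w - Q / w] is expanded at a time; this shifts the exponent of [w] both
   ways, hence the additional [w ^ a]. *)
have ratT k (a : int) : \sum_(w <- ws) th w ^+ k * w ^ a \in Crat.
  elim: k a => [|k IH] a.
    by under eq_bigr do rewrite expr0 mul1r; apply: ratW.
  have -> : \sum_(w <- ws) th w ^+ k.+1 * w ^ a =
      B * (\sum_(w <- ws) th w ^+ k * w ^ a) - \sum_(w <- ws) th w ^+ k * w ^ (a + 1)
      - Q%:R * \sum_(w <- ws) th w ^+ k * w ^ (a - 1).
    rewrite !mulr_sumr -!sumrB big_seq [RHS]big_seq; apply: eq_bigr => w hw.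
    rewrite !expfzDr ?unitw // expr1z exprN1 exprSr {2}/th conjE //; ring.
  by rewrite !rpredB // rpredM ?IH ?rpred_int ?rpred_nat.
(* Up to sign the product is the last coefficient of [rev_roots] of the [th w], which Newton's
   identities express rationally by their power sums. *)
have ratP : \prod_(w <- ws) th w \in Crat.
  have := @Crat_rev_roots (map th ws) (size (map th ws)) _.
  rewrite coef_rev_roots // subnn coef0_prod_XsubC big_map rpredMsign; apply=> r _.
  rewrite big_map; have := ratT r 0.
  by have -> : \sum_(w <- ws) th w ^+ r * w ^ 0 = \sum_(w <- ws) th w ^+ r;
    [apply: eq_bigr => w _; rewrite expr0z mulr1|].
have intP : \prod_(w <- ws) th w \is a Num.int.
  apply: Cint_rat_Aint => //; rewrite big_seq rpred_prod // => w hw.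
  apply: rpredB; first by apply: rpredB; [apply: Aint_int | apply: wA].
  by rewrite Aint_aut wA.
have pos w : w \in ws -> 0 < th w.
  move=> hw; rewrite /th -addrA -opprD subr_gt0.
  have hw2 : w + w^* <= 2%:R * sqrtC Q%:R.
    have -> : sqrtC Q%:R = `|w| by rewrite -(hN w hw) sqrCK.
    apply: (le_trans (real_ler_norm _)).
      by rewrite CrealE rmorphD /= conjCK addrC.
    by rewrite (le_trans (ler_normD _ _)) // norm_conjC mulr_natl mulr2n.
  apply: (le_lt_trans hw2); apply: real_floorD1_gt.
  by rewrite ger0_real // mulr_ge0 ?ler0n // sqrtC_ge0 ler0n.
have := @ge1_prod_sum (map th ws); rewrite size_map !big_map => H.
have : (size ws)%:R <= \sum_(w <- ws) th w.
  apply: H; first by move=> _ /mapP[w hw ->]; apply: pos.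
  have p0 : 0 < \prod_(w <- ws) th w by rewrite big_seq prodr_gt0.
  by rewrite -(ger0_norm (ltW p0)) norm_intr_ge1 // lt0r_neq0.
have -> : \sum_(w <- ws) th w = B * (size ws)%:R - \sum_(w <- ws) (w + w^*).
  under eq_bigr do rewrite /th -addrA -opprD.
  by rewrite sumrB big_const_seq iter_addr_0 count_predT mulr_natr.
by rewrite /B intrD mulrDl mul1r lerBrDr addrC lerD2r.
Qed.

(** * The exponents [Lead] *)

Lemma bigminn_le (I : eqType) (r : seq I) (P : pred I) (G : I -> nat) N i :
  i \in r -> P i -> (\big[minn/N]_(k <- r | P k) G k <= G i)%N.
Proof.
move=> + Pi; elim: r => // k r IH; rewrite inE big_cons => /predU1P[<-|hi].
  by rewrite Pi geq_minl.
by case: ifP => _; rewrite ?geq_min IH ?orbT.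
Qed.

Lemma bigminn_attained (I : eqType) (r : seq I) (P : pred I) (G : I -> nat) N :
  \big[minn/N]_(k <- r | P k) G k = N \/
  exists i, [/\ i \in r, P i & \big[minn/N]_(k <- r | P k) G k = G i].
Proof.
elim: r => [|k r IH]; first by left; rewrite big_nil.
rewrite big_cons; case: ifP => Pk; last first.
  case: IH => [->|[i [ir Pi ->]]]; [by left|right].
  by exists i; rewrite inE ir orbT.
case: (leqP (G k) (\big[minn/N]_(j <- r | P j) G j)) => hle.
  by right; exists k; rewrite inE eqxx.
case: IH => [->|[i [ir Pi ->]]]; [by left|right].
by exists i; rewrite inE ir orbT.
Qed.

(** [x] itself is admissible, with [u = 0], so the minimum is attained and the default [N] is not
    returned. *)
Lemma LeadP p N x : (x < N)%N ->
  [/\ (Lead p N x < N)%N, exists u, Lead p N x = x * p ^ u %[mod N] &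
      forall k, (k < N)%N -> (exists u, k = x * p ^ u %[mod N]) -> (Lead p N x <= k)%N].
Proof.
move=> hx.
have hle k : (k < N)%N -> (exists u, k = x * p ^ u %[mod N]) -> (Lead p N x <= k)%N.
  move=> hk hu; rewrite /Lead.
  apply: (@bigminn_le _ _ _ (fun k : 'I_N => k : nat) N (Ordinal hk)).
    by rewrite mem_index_enum.
  exact/boolp.asboolP.
have hxx : (Lead p N x <= x)%N by apply: hle => //; exists 0%N; rewrite expn0 muln1.
have hlt : (Lead p N x < N)%N by apply: leq_ltn_trans hx.
split=> //; have [e|[i [_ /boolp.asboolP hi e]]] :=
  bigminn_attained (index_enum 'I_N) (fun k : 'I_N => boolp.asbool (exists u, k = x * p ^ u %[mod N])) (fun k : 'I_N => k : nat) N.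
  by move: hlt; rewrite /Lead e ltnn.
by rewrite /Lead e.
Qed.

Lemma Res_nat N y : (0 < N)%N -> Res N (y%:Z) = (y %% N)%N.
Proof. by move=> N0; rewrite /Res modz_nat. Qed.

Section Exponents.
Variables (p m n j : nat).
Hypotheses (p_pr : prime p) (m0 : (0 < m)%N) (n1 : (1 < n)%N).
Notation q := (p ^ m)%N.
Notation N := (q ^ n - 1)%N.
Notation M := (m * n)%N.
Hypothesis cj : coprime j N.

Definition expo i := Lead p N (Res N (j%:Z * ((q ^ i)%:Z - 1))).

Let p1 : (1 < p)%N. Proof. exact: prime_gt1. Qed.
Let M1 : (1 < M)%N. Proof. by rewrite (leq_trans n1) // leq_pmull. Qed.
Let qnE : (q ^ n = p ^ M)%N. Proof. by rewrite -expnM. Qed.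
Let pM_gt : (3 < p ^ M)%N.
Proof.
apply: (@leq_trans (2 ^ 2)) => //; apply: (@leq_trans (p ^ 2)).
  by rewrite leq_exp2r.
by rewrite leq_exp2l.
Qed.
Let N0 : (0 < N)%N. Proof. by rewrite qnE; lia. Qed.
Let N_succ : N.+1 = (p ^ M)%N. Proof. by rewrite qnE; lia. Qed.

Lemma pM_mod : p ^ M = 1 %[mod N].
Proof. by rewrite -N_succ -addn1 -modnDml modnn. Qed.

Lemma pMX_mod y k : y * p ^ (M * k) = y %[mod N].
Proof. by rewrite expnM -modnMmr -modnXm pM_mod modnXm exp1n modnMmr muln1. Qed.

Lemma p_exp_mod v : p ^ v = p ^ (v %% M) %[mod N].
Proof. by rewrite {1}(divn_eq v M) expnD mulnC [(_ * M)%N]mulnC pMX_mod. Qed.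

Lemma Res_expo i : Res N (j%:Z * ((q ^ i)%:Z - 1)) = (j * (q ^ i - 1) %% N)%N.
Proof.
have -> : j%:Z * ((q ^ i)%:Z - 1) = (j * (q ^ i - 1))%N%:Z.
  by rewrite PoszM subzn // expn_gt0 expn_gt0 ltnW.
exact: Res_nat.
Qed.

Lemma expoP i : exists u, expo i = j * (q ^ i - 1) * p ^ u %[mod N].
Proof.
rewrite /expo Res_expo; have [_ [u hu] _] := @LeadP p N (j * (q ^ i - 1) %% N) (ltn_pmod _ N0).
by exists u; rewrite hu modnMml.
Qed.

Lemma expo_lt i : (expo i < N)%N.
Proof. by rewrite /expo Res_expo; case: (@LeadP p N (j * (q ^ i - 1) %% N) (ltn_pmod _ N0)). Qed.

Lemma expo_min i k u : (k < N)%N -> k = j * (q ^ i - 1) * p ^ u %[mod N] -> (expo i <= k)%N.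
Proof.
move=> hk hu; rewrite /expo Res_expo.
have [_ _] := @LeadP p N (j * (q ^ i - 1) %% N) (ltn_pmod _ N0); apply => //.
by exists u; rewrite modnMml.
Qed.

Lemma coprime_pN u : coprime N (p ^ u).
Proof.
apply: coprimeXr; rewrite -(coprime_pexpr _ _ (ltnW M1)) -N_succ.
by rewrite coprime_sym coprimeSn.
Qed.

(** [j] and [p^u] are prime to [N], so the value 0 would make [N] divide [q^i - 1], which is
    positive and smaller. *)
Lemma expo_gt0 i : (0 < i < n)%N -> (0 < expo i)%N.
Proof.
case/andP => i0 hi; rewrite lt0n; apply/eqP => e; have [u] := expoP i.
rewrite e mod0n => /esym/eqP; rewrite -/(dvdn _ _) Gauss_dvdl ?coprime_pN //.
rewrite Gauss_dvdr 1?coprime_sym // => /dvdn_leq.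
have h1 : (q ^ i < q ^ n)%N by rewrite ltn_exp2l // -(exp1n m) ltn_exp2r.
have h2 : (1 < q ^ i)%N by rewrite -(exp1n i) ltn_exp2r // -(exp1n m) ltn_exp2r.
rewrite subn_gt0 h2 => /(_ isT); rewrite leqNgt => /negP; apply.
by apply: ltn_sub2r => //; apply: ltn_trans h1.
Qed.

(** Division by [p] stays in the cyclotomic coset, as [p^(M-1)] is an inverse of [p] modulo [N]; so
    the least element is not a multiple of [p]. *)
Lemma expo_ndvd i : (0 < i < n)%N -> ~~ (p %| expo i)%N.
Proof.
move=> hi; apply/negP => /dvdnP[k hk]; have [u hu] := expoP i.
have k0 : (0 < k)%N by have := expo_gt0 hi; rewrite hk; case: k {hk}.
have hkp : (k < k * p)%N by rewrite ltn_Pmulr.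
suff : (expo i <= k)%N by rewrite hk leqNgt hkp.
have hkN : (k < N)%N by apply: ltn_trans (expo_lt i); rewrite hk.
apply: (@expo_min _ _ (u + M.-1) hkN).
rewrite expnD mulnA -modnMml -hu modnMml hk -mulnA -expnS prednK ?(ltnW M1) //.
by have := pMX_mod k 1; rewrite muln1.
Qed.

(** Both sides are so small that the congruence is an equality. Modulo [p], [b > 0] would force
    [c = 0], and 2 is not a sum of two powers of [p] with positive exponents. *)
Lemma two_powers a b c : (a < M)%N -> (b < M)%N -> (c < M)%N -> (0 < a)%N ->
  p ^ a + p ^ b = p ^ c + 1 %[mod N] -> a = c /\ b = 0%N.
Proof.
move=> ha hb hc a0 hmod.
have bound x : (x < M)%N -> (0 < p ^ x /\ 2 * p ^ x <= p ^ M)%N.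
  move=> hx; split; first by rewrite expn_gt0 ltnW.
  by apply: (@leq_trans (p ^ x.+1)); [rewrite expnS leq_mul2r p1 orbT | rewrite leq_exp2l].
have [a1 a2] := bound a ha; have [b1 b2] := bound b hb; have [c1 c2] := bound c hc.
have e : (p ^ a + p ^ b = p ^ c + 1)%N.
  move: hmod pM_gt N_succ a1 a2 b1 b2 c1 c2; move: (p ^ a)%N (p ^ b)%N (p ^ c)%N (p ^ M)%N N.
  move=> A B C P n' hmod hP hn a1 a2 b1 b2 c1 c2.
  move/eqP: hmod; case: (leqP (A + B) (C + 1)) => hle; last first.
    rewrite eqn_mod_dvd ?(ltnW hle) // => /dvdn_leq; lia.
  rewrite eq_sym eqn_mod_dvd // => hd; have := dvdn_leq _ hd; lia.
have b0 : b = 0%N.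
  case: b hb hmod b1 b2 e => // b _ _ _ _ e.
  have : (p %| p ^ c + 1)%N by rewrite -e dvdn_add // dvdn_exp.
  case: c hc c1 c2 e => [|c] _ _ _ e; last first.
    by rewrite dvdn_addr ?dvdn_exp // dvdn1 gtn_eqF.
  move=> _; move: e; rewrite expn0 => e.
  have h1 x : (2 <= p ^ x.+1)%N.
    by rewrite expnS (leq_trans p1) // leq_pmulr // expn_gt0 ltnW.
  by have := leq_add (h1 a.-1) (h1 b); rewrite prednK // e.
split=> //; move: e; rewrite b0 expn0 => /addIn /eqP.
by rewrite eqn_exp2l // => /eqP.
Qed.

(** After cancelling [j], the equality becomes [p^(m i) + p^t = p^(m i' + t) + 1] modulo [N], a case
    of [two_powers]. Distinct exponents keep the twisted monomials from cancelling. *)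
Lemma expo_inj i i' : (0 < i < n)%N -> (0 < i' < n)%N -> expo i = expo i' -> i = i'.
Proof.
move=> /andP[i0 hi] /andP[i'0 hi'] e; have [u hu] := expoP i; have [u' hu'] := expoP i'.
have h : (q ^ i - 1) * p ^ u = (q ^ i' - 1) * p ^ u' %[mod N].
  have : j * ((q ^ i - 1) * p ^ u) = j * ((q ^ i' - 1) * p ^ u') %[mod N].
    by rewrite !mulnA -hu -hu' e.
  move: ((q ^ i - 1) * p ^ u)%N ((q ^ i' - 1) * p ^ u')%N => y y' /eqP.
  wlog hle : y y' / (y' <= y)%N => [H|].
    by case/orP: (leq_total y y') => hl hm; [apply: esym|]; apply: H => //; rewrite eq_sym.
  rewrite eqn_mod_dvd ?leq_mul2l ?hle ?orbT // -mulnBr Gauss_dvdr 1?coprime_sym //.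
  by rewrite -eqn_mod_dvd // => /eqP.
(* [p^(u * M.-1)] is an inverse of [p^u] modulo [N], which gathers both twists on one side. *)
pose t := (u * M.-1 + u')%N.
have h2 : q ^ i - 1 = (q ^ i' - 1) * p ^ t %[mod N].
  rewrite -[LHS](pMX_mod _ u) -[M in LHS](prednK (ltnW M1)) mulSn expnD mulnA.
  by rewrite -modnMml h modnMml -mulnA -expnD addnC [(_ * u)%N]mulnC.
have hq k : (q ^ k = p ^ (m * k))%N by rewrite expnM.
have hp x : (0 < p ^ x)%N by rewrite expn_gt0 ltnW.
have h3 : p ^ (m * i) + p ^ t = p ^ (m * i' + t) + 1 %[mod N].
  have hle : (p ^ t <= p ^ (m * i' + t))%N by rewrite leq_exp2l // leq_addl.
  rewrite -(subnK (hp (m * i)%N)) -hq -addnA -modnDml h2 modnDml.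
  by rewrite mulnBl mul1n hq -expnD addnCA subnK // addnC.
have h4 : p ^ (m * i) + p ^ (t %% M) = p ^ ((m * i' + t) %% M) + 1 %[mod N].
  by rewrite -modnDmr -p_exp_mod modnDmr h3 -modnDml p_exp_mod modnDml.
have M0 := ltnW M1.
have lt_im k : (k < n)%N -> (m * k < M)%N by rewrite ltn_pmul2l.
have [] := two_powers (lt_im _ hi) (ltn_pmod _ M0) (ltn_pmod _ M0) _ h4.
  by rewrite muln_gt0 m0.
move=> h5 h6; move: h5; rewrite -modnDmr h6 addn0 modn_small ?lt_im // => /eqP.
by rewrite eqn_pmul2l // => /eqP.
Qed.

End Exponents.

(** * The trace of [L(x) / x] *)

Section AbsoluteCharacter.
Variables (R : finFieldType) (p m : nat).
Hypotheses (p_pr : prime p) (m0 : (0 < m)%N) (cardR : #|R| = (p ^ m)%N).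

Let pR : p \in [pchar R]. Proof. exact: card_finPcharP cardR p_pr. Qed.
Let pnat_p i : [pchar R].-nat (p ^ i)%N.
Proof. by rewrite pnatX (eq_pnat _ (pcharf_eq pR)) pnat_id. Qed.

Let t (c : R) := \sum_(i < m) c ^+ (p ^ i).

Lemma abs_traceX c : t (c ^+ p) = t c.
Proof.
rewrite /t -(big_mkord xpredT (fun i => c ^+ (p ^ i))) -(big_mkord xpredT (fun i => (c ^+ p) ^+ (p ^ i))).
under eq_bigr do rewrite -exprM -expnS.
apply: (@addrI _ (c ^+ (p ^ 0))).
rewrite -(@big_nat_recl _ _ _ m 0 (fun i => c ^+ (p ^ i))) // big_nat_recr //=.
by rewrite -cardR expf_card expn0 expr1 addrC.
Qed.

(** The trace is a root of [X^p - X], and the images of [0, ..., p - 1] are already all the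
    roots. *)
Lemma abs_trace_nat c : exists k, t c = k%:R.
Proof.
have ht : t c ^+ p = t c.
  rewrite -[RHS]abs_traceX /t expr_sum_pchar; last by rewrite -(expn1 p).
  by apply: eq_bigr => i _; rewrite exprAC.
apply: boolp.contrapT => hk.
have hP : 'X^p - 'X = 0 :> {poly R}.
  apply: (@roots_geq_poly_eq0 _ _ (t c :: [seq k%:R | k <- iota 0 p])).
  - rewrite /= /root !hornerE ht subrr eqxx /=; apply/allP => _ /mapP[k _ ->].
    by rewrite !hornerE -(pFrobenius_autE pR) pFrobenius_aut_nat subrr.
  - rewrite /=; apply/andP; split; first by apply/mapP => -[k _ e]; apply: hk; exists k.
    rewrite map_inj_in_uniq ?iota_uniq // => i k; rewrite !mem_iota /= !add0n.
    wlog hik : i k / (i <= k)%N => [H hi hk' e|hi hk' /eqP].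
      by case/orP: (leq_total i k) => h; [|apply: esym]; apply: H.
    rewrite eq_sym -subr_eq0 -natrB // -(dvdn_pcharf pR) => hd.
    apply/eqP; rewrite eqn_leq hik -subn_eq0 -leqn0 leqNgt; apply/negP => h0.
    by have := dvdn_leq h0 hd; rewrite leqNgt (leq_ltn_trans (leq_subr _ _)).
  rewrite size_polyDl ?size_polyXn; first by rewrite /= size_map size_iota.
  by rewrite size_polyN size_polyX ltnS prime_gt1.
have := congr1 (fun P : {poly R} => P`_p) hP.
rewrite coefB coefXn coefX eqxx coef0 gtn_eqF ?prime_gt1 // subr0 => /eqP.
by rewrite oner_eq0.
Qed.

(** A primitive [p]-th root of unity is raised to the absolute trace, which is Frobenius-invariant
    with values in the prime field. *)
Lemma absolute_character : exists phi : R -> algC,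
  [/\ addchar phi, exists c, phi c != 1 & forall c, phi (c ^+ p) = phi c].
Proof.
have [z hz] := C_prim_root_exists (prime_gt0 p_pr).
have [k hk] := boolp.choice abs_trace_nat.
have zE i j : i%:R = j%:R :> R -> z ^+ i = z ^+ j.
  wlog hij : i j / (j <= i)%N => [H h|].
    by case/orP: (leq_total j i) => hl; [exact: H | apply/esym/H].
  move/eqP; rewrite -subr_eq0 -natrB // -(dvdn_pcharf pR) => hd.
  by apply/eqP; rewrite (eq_prim_root_expr hz) eqn_mod_dvd.
exists (fun c => z ^+ k c); split.
- split=> [|x y].
    rewrite -[RHS](expr0 z); apply: zE; rewrite -hk /t big1 // => i _.
    by rewrite expr0n gtn_eqF // expn_gt0 prime_gt0.
  rewrite -exprD; apply: zE; rewrite natrD -!hk /t -big_split; apply: eq_bigr => i _.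
  by rewrite exprDn_pchar.
(* If the character were trivial, the trace polynomial, whose degree is below [p^m], would vanish on
   all of [R]. *)
- apply: boolp.contrapT => hall; pose P : {poly R} := \sum_(i < m) 'X^(p ^ i).
  have h1 : P = 0.
    apply: (@roots_geq_poly_eq0 _ _ (enum R)).
    + apply/allP => c _; rewrite /root /P horner_sum.
      have -> : \sum_(i < m) ('X^(p ^ i)).[c] = t c by apply: eq_bigr => i _; rewrite hornerXn.
      rewrite hk -(dvdn_pcharf pR) (prim_order_dvd hz).
      by apply: boolp.contrapT => /negP hc; apply: hall; exists c.
    + exact: enum_uniq.
    rewrite -cardE cardR (leq_trans (size_sum _ _ _)) //; apply/bigmax_leqP => i _.
    by rewrite size_polyXn ltn_exp2l ?prime_gt1.
  have : P`_1 = 1.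
    rewrite /P coef_sum (bigD1 (Ordinal m0)) //= big1 => [|i hi].
      by rewrite coefXn expn0 eqxx addr0.
    rewrite coefXn -[X in X == _](expn0 p) eqn_exp2l ?prime_gt1 //.
    by rewrite eq_sym; move: hi; rewrite -val_eqE /= => /negPf ->.
  by rewrite h1 coef0 => /eqP; rewrite eq_sym oner_eq0.
by move=> c; apply: zE; rewrite -!hk abs_traceX.
Qed.

End AbsoluteCharacter.

Lemma expsum1 (F : finFieldType) (K : closedFieldType) (emb : {rmorphism F -> K})
    (psi : F -> algC) (f : {poly F}) :
  expsum emb psi f 1 = \sum_c psi f.[c].
Proof.
have hp : perm_eq (Fix F K 1) [seq emb c | c <- enum F].
  apply: uniq_perm; first exact: (uniq_Fix emb).
    by rewrite map_inj_uniq ?enum_uniq //; apply: fmorph_inj.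
  move=> z; rewrite mem_Fix // expn1; apply/eqP/mapP => [/(emb_fixed emb)[c ->]|[c _ ->]].
    by exists c; rewrite ?mem_enum.
  by have := emb_Frob emb c 1; rewrite expn1.
rewrite /expsum (perm_big _ hp) big_map big_enum /=; apply: eq_bigr => c _; congr psi.
rewrite horner_map; apply: (fmorph_inj emb).
rewrite emb_Ftrace ?emb_Frob //.
by rewrite /Ktrace big_ord1 expn0 expr1.
Qed.

Lemma Ftrace0 (F : finFieldType) (K : closedFieldType) (emb : {rmorphism F -> K}) r :
  Ftrace emb r 0 = 0.
Proof.
have Q0 : (0 < #|F|)%N by apply: ltnW (card_gt1 F).
apply: (fmorph_inj emb); rewrite emb_Ftrace ?rmorph0.
  by rewrite /Ktrace big1 // => i _; rewrite expr0n gtn_eqF // expn_gt0 Q0.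
by rewrite expr0n gtn_eqF // expn_gt0 Q0.
Qed.

Lemma FtraceD (F : finFieldType) (K : closedFieldType) (emb : {rmorphism F -> K}) r x y :
  x ^+ (#|F| ^ r) = x -> y ^+ (#|F| ^ r) = y ->
  Ftrace emb r (x + y) = Ftrace emb r x + Ftrace emb r y.
Proof.
move=> hx hy; apply: (fmorph_inj emb); rewrite rmorphD !emb_Ftrace ?(KtraceD emb) //.
by rewrite exprDn_pchar ?(cardX_pnat emb) // hx hy.
Qed.

(** The hypothesis compares integers, which is how it passes from [algC] to [rat]. *)
Lemma HW_bound_le q n l (D : nat) : (0 < q)%N -> (0 < l)%N ->
  ((q ^ n)%:R - D%:R) *+ 2 <=
    (Num.floor (2%:R * sqrtC (q%:R : algC) ^+ n))%:~R * ((q - 1) * (l - 1))%N%:R :> algC ->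
  HW_bound q n l <= 1 + D%:R.
Proof.
rewrite /HW_bound; set h := Num.floor _; set A := ((q - 1) * (l - 1))%N => q0 l0.
have -> : ((q ^ n)%:R - D%:R) *+ 2 = (((q ^ n)%:Z - D%:Z) *+ 2)%:~R :> algC.
  by rewrite rmorphMn rmorphB.
have -> : h%:~R * A%:R = (h * A%:Z)%:~R :> algC by rewrite intrM.
rewrite ler_int -(ler_int rat) rmorphMn rmorphB rmorphM /=.
have -> : A%:~R = (q%:R - 1) * (l%:R - 1) :> rat.
  by rewrite -pmulrn /A natrM !natrB.
rewrite -!pmulrn; move: h%:~R (q ^ n)%:R D%:R (q%:R - 1) (l%:R - 1) => x y z u v hle.
lra.
Qed.

(** * The bound for a fixed [j] when the trace never vanishes *)

Section Main.
Variables (p m n : nat) (Fq L : finFieldType) (alg : {rmorphism Fq -> L}) (tr : L -> Fq).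
Notation q := (p ^ m)%N.
Hypotheses (p_pr : prime p) (m0 : (0 < m)%N) (n1 : (1 < n)%N).
Hypotheses (cardFq : #|Fq| = q) (cardL : #|L| = (q ^ n)%N).
Hypothesis trD : forall x y, tr (x + y) = tr x + tr y.
Hypothesis trZ : forall b x, tr (alg b * x) = b * tr x.
Hypothesis trX : forall x, tr (x ^+ p) = tr x ^+ p.
Variables (a : 'I_n -> L) (hn : (0 < n)%N).
Hypothesis ha : exists2 i : 'I_n, (0 < i)%N & a i != 0.
Hypothesis hL : forall x : L, x != 0 -> tr ((linearized q a).[x] / x) != 0.
Notation N := (q ^ n - 1)%N.

Lemma linearized_div j x : x != 0 -> (linearized q a).[x ^+ j] / x ^+ j =
  \sum_(i < n) a i * x ^+ (j * (q ^ i - 1)).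
Proof.
move=> x0; rewrite /linearized horner_sum mulr_suml; apply: eq_bigr => i _.
rewrite !hornerE -mulrA; congr (_ * _).
have q0 : (0 < q ^ i)%N by rewrite !expn_gt0 prime_gt0.
rewrite -exprM -{1}(subnK q0) mulnDr muln1 exprD -mulrA mulfV ?mulr1 //.
by rewrite expf_neq0.
Qed.

Variable j : nat.
Hypothesis cj : coprime j N.
Notation e := (expo p m n j).
Let used (i : 'I_n) := (0 < i)%N && (a i != 0).

Let pL : p \in [pchar L].
Proof. by apply: (@card_finPcharP _ p (m * n)); rewrite // cardL expnM. Qed.

Let pnat_p i : [pchar L].-nat (p ^ i)%N.
Proof. by rewrite pnatX (eq_pnat _ (pcharf_eq pL)) pnat_id. Qed.

Let e_neq (i i' : 'I_n) : (0 < i)%N -> (0 < i')%N -> e i = e i' -> i = i'.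
Proof. by move=> i0 i'0 h; apply/val_inj/(expo_inj p_pr m0 n1 cj) => //; rewrite ?i0 ?i'0 ltn_ord. Qed.

Lemma ell_at_attained : exists2 i : 'I_n, used i &
  ell_at p q a j = e i /\ forall i', used i' -> (e i' <= e i)%N.
Proof.
have [i0 i00 ai0] := ha.
have u0 : used i0 by rewrite /used i00.
have [i ui hmax] := @arg_maxnP _ i0 used (fun i : 'I_n => e i) u0.
exists i => //; split=> //; apply/eqP; rewrite eqn_leq; apply/andP; split.
  by apply/bigmax_leqP => i' ui'; apply: hmax.
exact: (@leq_bigmax_cond _ used (fun i : 'I_n => e i)).
Qed.

Lemma twisted_exponents : exists u : 'I_n -> nat,
  forall (i : 'I_n) (x : L), x != 0 -> x ^+ e i = (x ^+ (j * (q ^ i - 1))) ^+ (p ^ u i).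
Proof.
have [u hu] := fin_all_exists (fun i : 'I_n => expoP p_pr m0 n1 cj i).
exists u => i x x0.
have xN : x ^+ N = 1.
  apply: (mulIf x0); rewrite mul1r -exprSr subn1 prednK ?expn_gt0 ?prime_gt0 //.
  by rewrite -cardL expf_card.
rewrite -exprM (divn_eq (e i) N) (divn_eq (j * (q ^ i - 1) * p ^ u i) N) -hu.
by rewrite !exprD ![(_ * N)%N]mulnC !exprM xN !expr1n.
Qed.

Lemma trace_bound :
  HW_bound q n (ell_at p q a j) <= 1 + (if tr (a (Ordinal hn)) == 0 then q%:R else 0).
Proof.
have [phi [hphi [c0 hc0] phiX]] := absolute_character p_pr m0 cardFq.
pose psi (z : L) := phi (tr z).
have tr0 : tr 0 = 0 by apply: (@addrI _ (tr 0)); rewrite -trD !addr0.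
have hpsi : addchar psi.
  by split=> [|x y]; rewrite /psi ?tr0 ?trD; case: hphi => // _ ->.
have psiX z k : psi (z ^+ (p ^ k)) = psi z.
  elim: k => [|k IH]; first by rewrite expn0 expr1.
  by rewrite expnSr exprM /psi trX phiX.
have psi_neq1 : exists z, psi z != 1.
  have h := hL (oner_neq0 L); set w := _ / 1 in h.
  by exists (alg (c0 / tr w) * w); rewrite /psi trZ divfK.
have [i1 ui1 [ell_i1 hmax]] := ell_at_attained.
have [u hu] := twisted_exponents.
have e0 (i : 'I_n) : (0 < i)%N -> (0 < e i)%N.
  by move=> i0; apply: (expo_gt0 p_pr m0 n1 cj); rewrite i0 ltn_ord.
have i10 : (0 < i1)%N by case/andP: ui1.
pose l := e i1; have l0 : (0 < l)%N := e0 _ i10.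
(* [f b] is [b L(x^j)/x^j] with each nonconstant monomial replaced by its [p]-power twist, which
   [psi] does not distinguish at nonzero points. *)
pose f (b : Fq) : {poly L} := (alg b * a (Ordinal hn))%:P +
  \sum_(i < n | used i) ((alg b * a i) ^+ (p ^ u i)) *: 'X^(e i).
have size_f b : b != 0 -> size (f b) = l.-1.+2.
  move=> b0; rewrite prednK //.
  have hc : (f b)`_l != 0.
    rewrite /f coefD coefC gtn_eqF // add0r coef_sum (bigD1 i1) //= big1 => [|i /andP[ui hi]].
      rewrite addr0 coefZ coefXn eqxx mulr1 expf_neq0 // mulf_neq0 ?fmorph_eq0 //.
      by case/andP: ui1.
    rewrite coefZ coefXn; case: eqP => [h|_]; last by rewrite mulr0.
    by move: hi; rewrite (e_neq _ _ (esym h)) ?eqxx //; case/andP: ui.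
  apply/eqP; rewrite eqn_leq; apply/andP; split.
    apply: (leq_trans (size_polyD _ _)); rewrite geq_max.
    rewrite (leq_trans (size_polyC_leq1 _)) //= (leq_trans (size_sum _ _ _)) //.
    apply/bigmax_leqP => i ui; rewrite (leq_trans (size_scale_leq _ _)) // size_polyXn ltnS.
    exact: hmax.
  by rewrite ltnNge; apply: contra hc => /leq_sizeP h; rewrite h.
(* Twisting by powers of [p] keeps [f] additive in [b]; the rationality of the power sums rests on
   this. *)
have fD b b' : f (b + b') = f b + f b'.
  rewrite /f !rmorphD /= mulrDl polyCD addrACA -big_split; congr (_ + _).
  apply: eq_bigr => i _; rewrite mulrDl exprDn_pchar ?pnat_p // scalerDl //.
have f0 : f 0 = 0.
  by apply: (@addrI _ (f 0)); rewrite -fD !addr0.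
have ldvd : l.-1.+1%:R != 0 :> L.
  rewrite prednK // -(dvdn_pcharf pL); apply: (expo_ndvd p_pr m0 n1 cj).
  by rewrite i10 ltn_ord.
have [K [emb _]] := countable_algebraic_closure L.
have hw b : exists ws : seq algC, b != 0 -> [/\ size ws = l.-1,
    rev_roots ws \is a polyOver Aint,
    (forall w, w \in ws -> `|w| ^+ 2 = #|L|%:R) &
    forall r, (0 < r)%N -> expsum emb psi (f b) r = - \sum_(w <- ws) w ^+ r].
  have [->|b0] := eqVneq b 0; first by exists [::].
  by have [ws hws] := weil emb hpsi psi_neq1 (size_f b b0) ldvd; exists ws.
have [ws hws] := fin_all_exists hw.
pose W := flatten [seq ws b | b <- enum Fq & b != 0].
have sumW (G : algC -> algC) : \sum_(w <- W) G w = \sum_(b | b != 0) \sum_(w <- ws b) G w.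
  by rewrite big_flatten big_map big_filter big_enum_cond.
have sizeW : size W = ((q - 1) * (l - 1))%N.
  rewrite -sum1_size big_flatten big_map big_filter big_enum_cond /=.
  rewrite (eq_bigr (fun _ => l - 1)%N) => [|b b0]; last first.
    by have [hsz _ _ _] := hws b b0; rewrite sum1_size hsz subn1.
  rewrite sum_nat_const; congr (_ * _)%N.
  by rewrite -cardFq subn1 -(cardC1 (0 : Fq)); apply: eq_card => b; rewrite !inE.
have AintW : rev_roots W \is a polyOver Aint.
  rewrite /rev_roots big_flatten big_map big_filter rpred_prod // => b b0.
  by have [_ h _ _] := hws b b0.
have normW w : w \in W -> `|w| ^+ 2 = (q ^ n)%:R.
  rewrite -cardL => /flatten_mapP[b]; rewrite mem_filter => /andP[b0 _].
  by have [_ _ h _] := hws b b0; apply: h.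
have f0sum r : (0 < r)%N -> expsum emb psi (f 0) r = (#|L| ^ r)%:R.
  move=> r0; rewrite -(size_Fix L K r0) /expsum f0 -sum1_size natr_sum.
  apply: eq_bigr => x _; rewrite rmorph0 horner0 Ftrace0 /psi tr0.
  by case: hphi.
have psumW r : (0 < r)%N -> \sum_(w <- W) w ^+ r =
    (#|L| ^ r)%:R - \sum_b expsum emb psi (f b) r.
  move=> r0; rewrite sumW [in RHS](bigD1 0) //= f0sum // opprD addNKr -sumrN.
  by apply: eq_bigr => b b0; have [_ _ _ ->] := hws b b0; rewrite ?opprK.
(* For fixed [x], [psi] of the trace of [f b] at [x] is an additive character in [b], so its sum
   over [b] is 0 or [#|Fq|]. *)
have ratW r : (0 < r)%N -> \sum_(w <- W) w ^+ r \in Crat.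
  move=> r0; rewrite psumW // rpredB ?rpred_nat // /expsum exchange_big /= big_seq rpred_sum // => x hx.
  have hz b : (map_poly emb (f b)).[x] ^+ (#|L| ^ r) = (map_poly emb (f b)).[x].
    by rewrite horner_Frob (FixP r0 hx).
  have hchi : addchar (fun b => psi (Ftrace emb r (map_poly emb (f b)).[x])).
    case: (hpsi) => h0 hD; split; first by rewrite f0 rmorph0 horner0 Ftrace0.
    by move=> b b'; rewrite fD rmorphD hornerD FtraceD ?hz // hD.
  by case: (sum_addchar hchi) => ->; rewrite ?rpred0 ?rpred_nat.
have psi_f b c : c != 0 ->
    psi (f b).[c] = phi (b * tr ((linearized q a).[c ^+ j] / c ^+ j)).
  move=> c0'; have [h0 hD] := hpsi.
  rewrite linearized_div // -trZ -/(psi _) /f hornerD hD hornerC horner_sum (addchar_sum hpsi).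
  rewrite mulr_sumr (addchar_sum hpsi) [in RHS](bigD1 (Ordinal hn)) //= expn0 subnn muln0 expr0 mulr1; congr (_ * _).
  rewrite [RHS](bigID used) /= [X in _ = _ * X]big1 ?mulr1 => [|i /andP[i0 hi]].
    apply: eq_big => [i|i ui].
      by rewrite /used andbC -val_eqE /= -lt0n; case: (0 < i)%N => //; rewrite andbF.
    by rewrite hornerZ hornerXn hu // -exprMn psiX mulrA.
  move: hi; rewrite /used negb_and -eqn0Ngt negbK => /orP[/eqP hi|/eqP ->].
    by case/eqP: i0; apply: val_inj.
  by rewrite mul0r mulr0.
(* When the sum over [b] is taken first, only points where the trace vanishes contribute. By [hL]
   this leaves at most [x = 0], where the trace is that of [a_0]. *)
have sumS : \sum_b expsum emb psi (f b) 1 = (if tr (a (Ordinal hn)) == 0 then q%:R else 0).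
  under eq_bigr do rewrite expsum1.
  have nontriv w : w != 0 -> \sum_b phi (b * w) = 0.
    move=> w0; apply: sum_addchar_eq0; last by exists (c0 / w); rewrite divfK.
    case: (hphi) => h0 hD; split; first by rewrite mul0r.
    by move=> b b'; rewrite mulrDl hD.
  rewrite exchange_big (bigD1 0) //= [X in _ + X]big1 ?addr0 => [|c c0']; last first.
    under eq_bigr do rewrite psi_f //.
    by apply/nontriv/hL; rewrite expf_neq0.
  have psi_f0 b : psi (f b).[0] = phi (b * tr (a (Ordinal hn))).
    rewrite -trZ -/(psi _) /f hornerD hornerC horner_sum big1 ?addr0 // => i /andP[i0 _].
    by rewrite hornerZ hornerXn expr0n gtn_eqF ?mulr0 // e0.
  under eq_bigr do rewrite psi_f0.
  case: eqP => [->|/eqP]; last exact: nontriv.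
  under eq_bigr do rewrite mulr0.
  by case: hphi => -> _; rewrite sumr_const cardFq.
have Q0 : (0 < q ^ n)%N by rewrite !expn_gt0 prime_gt0.
pose D : nat := if tr (a (Ordinal hn)) == 0 then q else 0%N.
have DE (R : pzSemiRingType) : (if tr (a (Ordinal hn)) == 0 then q%:R else 0) = D%:R :> R.
  by rewrite /D; case: ifP.
have V1 : \sum_(w <- W) w = (q ^ n)%:R - D%:R.
  have := psumW 1%N isT; rewrite sumS expn1 cardL DE => <-.
  by apply: eq_bigr => w _; rewrite expr1.
have V2 : \sum_(w <- W) w^* = (q ^ n)%:R - D%:R.
  by rewrite -rmorph_sum V1 rmorphB /= !rmorph_nat.
have sqrtE : sqrtC (q ^ n)%:R = sqrtC q%:R ^+ n :> algC by rewrite natrX rootCX ?ler0n.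
have := serre Q0 normW AintW ratW.
rewrite big_split /= V1 V2 sizeW sqrtE DE ell_i1 -/l => hle.
by apply: HW_bound_le; [rewrite expn_gt0 prime_gt0 | | rewrite mulr2n].
Qed.

End Main.

(** * The trace as a map to the base field *)

Section TraceForm.
Variables (Fq : finFieldType) (L : splittingFieldType Fq).

Definition trace_form (x : L) : Fq := odflt 0 [pick c : Fq | c%:A == Tr x].

Lemma trace_formE x : (trace_form x)%:A = Tr x.
Proof.
have : Tr x \in 1%VS by apply: mem_galTrace (finField_galois (sub1v _)) (memvf x).
case/vlineP => c hc; rewrite /trace_form; case: pickP => [b /eqP //|/(_ c)].
by rewrite hc eqxx.
Qed.

Lemma trace_formP x c : Tr x = c%:A -> trace_form x = c.
Proof. by move=> h; apply: (fmorph_inj (in_alg L)); rewrite /= trace_formE. Qed.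

Lemma trace_formD x y : trace_form (x + y) = trace_form x + trace_form y.
Proof. by apply: trace_formP; rewrite scalerDl !trace_formE /Tr raddfD. Qed.

Lemma trace_formZ b x : trace_form (b%:A * x) = b * trace_form x.
Proof.
apply: trace_formP; rewrite -scalerA trace_formE mulr_algl /Tr /galTrace scaler_sumr.
by apply: eq_bigr => s _; rewrite linearZ.
Qed.

Lemma trace_formX p x : p \in [pchar Fq] -> trace_form (x ^+ p) = trace_form x ^+ p.
Proof.
move=> hp; have pL : [pchar L].-nat p.
  have pL : p \in [pchar L] by rewrite (fmorph_pchar (in_alg L)).
  by rewrite (eq_pnat _ (pcharf_eq pL)) pnat_id // (pcharf_prime hp).
apply: trace_formP; have := rmorphXn (in_alg L) p (trace_form x).
rewrite /= trace_formE => ->; rewrite /Tr /galTrace.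
by rewrite expr_sum_pchar //; apply: eq_bigr => s _; rewrite rmorphXn.
Qed.

Lemma trace_form_eq0 x : (trace_form x == 0) = (Tr x == 0).
Proof. by rewrite -trace_formE -[_%:A]/(in_alg L _) fmorph_eq0. Qed.

End TraceForm.

(** * Passage to the minimum over [j] and conclusion *)

(** [j = 1] is admissible since [N > 1], and its value is below [N]; so the minimum is not the
    default [N]. *)
Lemma ell_attained (R : nzRingType) (p m n : nat) (a : 'I_n -> R) :
  prime p -> (0 < m)%N -> (1 < n)%N -> (exists2 i : 'I_n, (0 < i)%N & a i != 0) ->
  exists2 j, coprime j ((p ^ m) ^ n - 1) & ell p (p ^ m) a = ell_at p (p ^ m) a j.
Proof.
move=> p_pr m0 n1 ha; set q := (p ^ m)%N; set N := (q ^ n - 1)%N.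
have q1 : (1 < q)%N by rewrite -(exp1n m) ltn_exp2r // prime_gt1.
have N1 : (1 < N)%N.
  rewrite ltn_subRL (@leq_trans (2 ^ 2)) // (@leq_trans (2 ^ n)) ?leq_exp2l //.
  by rewrite leq_exp2r // ltnW.
rewrite /ell -/q -/N; have [e|[j [_ cj ->]]] := bigminn_attained (index_iota 1 N) (fun j => coprime j N)
  (fun j => ell_at p q a j) N; last by exists j.
have c1 : coprime 1 N by apply: coprime1n.
have h : (N <= ell_at p q a 1)%N.
  by rewrite -{1}e; apply: bigminn_le; rewrite ?mem_index_iota ?N1.
have : (ell_at p q a 1 < N)%N.
  rewrite -(prednK (ltnW N1)) ltnS; apply/bigmax_leqP => i _.
  by rewrite -ltnS prednK ?(ltnW N1) //; apply: (expo_lt p_pr m0 n1 c1).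
by rewrite ltnNge h.
Qed.

Lemma HW_bound_no_zero (p m n : nat) (Fq : finFieldType) (L : splittingFieldType Fq)
    (hn : (0 < n)%N) (a : 'I_n -> L) :
  prime p -> (0 < m)%N -> #|Fq| = (p ^ m)%N -> \dim {:L} = n ->
  (exists2 i : 'I_n, (0 < i)%N & a i != 0) ->
  (forall x : L, x != 0 -> Tr ((linearized (p ^ m) a).[x] / x) != 0) ->
  HW_bound (p ^ m) n (ell p (p ^ m) a) <=
    1 + (if Tr (a (Ordinal hn)) == 0 then (p ^ m)%:R else 0).
Proof.
move=> p_pr m0 cardFq dimL ha hL.
have n1 : (1 < n)%N by case: ha => i i0 _; apply: leq_trans (ltn_ord i).
have [j cj ->] := ell_attained p_pr m0 n1 ha.
have pF : p \in [pchar Fq] by apply: card_finPcharP cardFq p_pr.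
rewrite -trace_form_eq0.
(* [finvect_type L] equips [L] with the finite field structure used for counting; its cardinality
   follows from the dimension. *)
have cardL : #|finvect_type L| = ((p ^ m) ^ n)%N.
  pose vL : vectType Fq := finvect_type L.
  have h := @card_vspacef Fq (finvect_type L) (Vector.class vL).
  by rewrite -h card_vspace cardFq -dimL.
apply: (@trace_bound p m n Fq (finvect_type L) (in_alg L) (@trace_form Fq L)) => //.
- exact (@trace_formD Fq L).
- exact (@trace_formZ Fq L).
- by move=> x; apply: trace_formX.
by move=> x x0; rewrite trace_form_eq0; apply: hL.
Qed.

Theorem theorem6p1 (p m n : nat) (hp : prime p) (hm : (0 < m)%N) (hn : (0 < n)%N)
    (q : nat) (hq : q = (p ^ m)%N)
    (Fq : finFieldType) (hFq : #|Fq| = q)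
    (Fqn : splittingFieldType Fq) (hFqn : \dim {:Fqn} = n)
    (a : 'I_n -> Fqn) (ha : exists2 i : 'I_n, (0 < i)%N & a i != 0) :
  (Tr (a (Ordinal hn)) != 0 ->
   HW_bound q n (ell p q a) > 1 ->
   ~ (forall x : Fqn, x != 0 -> Tr ((linearized q a).[x] / x) != 0)) /\
  (Tr (a (Ordinal hn)) = 0 ->
   HW_bound q n (ell p q a) > q%:R + 1 ->
   ~ (forall x : Fqn, x != 0 -> Tr ((linearized q a).[x] / x) != 0)).
Proof.
subst q; split=> [/negPf tr0 hb hL|tr0 hb hL].
  have := HW_bound_no_zero hn hp hm hFq hFqn ha hL.
  by rewrite tr0 addr0 leNgt hb.
have := HW_bound_no_zero hn hp hm hFq hFqn ha hL.
by rewrite tr0 eqxx addrC leNgt hb.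
Qed.
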